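(* Let $V$ be a non-zero finite dimensional $\mathbb{F}_q$-vector space. The ring $R_V$ is a Cohen-Macaulay normal integral domain.
   Context: $\mathbb{F}_q$ is a finite field with $q$ elements. Let $S_V$ be the symmetric algebra of $V$ over $\mathbb{F}_q$, $K_V$ its field of quotients, and $R_V\subset K_V$ the $\mathbb{F}_q$-subalgebra generated by $\frac1v$ for all $v\in V\setminus\{0\}$. *)

(* Defs.v *)
From HB Require Import structures.
From mathcomp Require Import all_boot all_order all_algebra.
From mathcomp Require Import mpoly boolp.

Set Implicit Arguments.
Unset Strict Implicit.
Unset Printing Implicit Defensive.

Import GRing.Theory.

Local Open Scope ring_scope.

Section SubDomain.

Variables (K : fieldType) (S : subringClosed K).

Record subdomain := SubDomain { subdomain_val : K; _ : subdomain_val \in S }.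

HB.instance Definition _ := [isSub for subdomain_val].
HB.instance Definition _ := [Choice of subdomain by <:].
HB.instance Definition _ := [SubChoice_isSubComNzRing of subdomain by <:].

Definition subdomain_unit : {pred subdomain} :=
  [pred x | (val x != 0) && ((val x)^-1 \in S)].

Definition subdomain_inv (x : subdomain) : subdomain :=
  if x \in subdomain_unit then insubd x (val x)^-1 else x.

Fact subdomain_mulVx : {in subdomain_unit, left_inverse 1 subdomain_inv *%R}.
Proof.
move=> x xU; apply: val_inj; rewrite /subdomain_inv xU.
case/andP: xU => x0 xS.
change (val (insubd x (val x)^-1) * val x = 1).
rewrite val_insubd xS.
exact: mulVf.
Qed.

Fact subdomain_unitPl (x y : subdomain) : y * x = 1 -> subdomain_unit x.
Proof.
move=> /(congr1 val); change (val y * val x = 1 -> subdomain_unit x) => yx1.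
have x0 : val x != 0.
  by apply: contra_eq_neq yx1 => ->; rewrite mulr0 eq_sym oner_neq0.
have xV : (val x)^-1 = val y by rewrite -[LHS]mul1r -yx1 mulfK.
by apply/andP; split=> //; rewrite xV; apply: valP.
Qed.

Fact subdomain_invx_out : {in [predC subdomain_unit], subdomain_inv =1 id}.
Proof. by move=> x xU; rewrite /subdomain_inv ifN. Qed.

HB.instance Definition _ := GRing.ComNzRing_hasMulInverse.Build subdomain
  subdomain_mulVx subdomain_unitPl subdomain_invx_out.

Fact subdomain_integral : GRing.integral_domain_axiom subdomain.
Proof.
move=> x y /(congr1 val); change (val x * val y = 0 -> (x == 0) || (y == 0)).
by move=> /eqP; rewrite mulf_eq0 -!(inj_eq val_inj).
Qed.

HB.instance Definition _ :=
  GRing.ComUnitRing_isIntegral.Build subdomain subdomain_integral.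

End SubDomain.

(* Ideals are the boolean predicates of ring_quotient.v; as excluded middle is
   available through boolp, this is no restriction on subsets. [idealr_closed]
   includes properness. *)

Section CommutativeAlgebra.

Variable A : comNzRingType.

Definition span_ideal (s : seq A) (x : A) : Prop :=
  exists c : 'I_(size s) -> A, x = \sum_(i < size s) c i * s`_i.

Definition noetherian : Prop :=
  forall I : {pred A}, idealr_closed I ->
  exists s : seq A, forall x, x \in I <-> span_ideal s x.

Definition maximal_ideal (M : {pred A}) : Prop :=
  idealr_closed M /\
  forall J : {pred A}, idealr_closed J -> {subset M <= J} -> {subset J <= M}.

Definition prime_chain (n : nat) (P : 'I_n.+1 -> prime_idealr A) : Prop :=
  forall i j : 'I_n.+1, (i < j)%N ->
  {subset P i <= P j} /\ ~ {subset P j <= P i}.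

Definition has_krull_dim (d : nat) : Prop :=
  (exists P : 'I_d.+1 -> prime_idealr A, prime_chain P) /\
  (forall (n : nat) (P : 'I_n.+1 -> prime_idealr A), prime_chain P -> (n <= d)%N).

(* s`_i is a nonzerodivisor on A / (s`_0, ..., s`_(i-1)), and A / (s) != 0 *)
Definition regular_seq (s : seq A) : Prop :=
  (forall (i : nat) (x : A), (i < size s)%N ->
     span_ideal (take i s) (s`_i * x) -> span_ideal (take i s) x) /\
  ~ span_ideal s 1.

End CommutativeAlgebra.

Section CohenMacaulayLocal.

Variable A : comUnitRingType.

Definition nonunits : {pred A} := [pred x | x \isn't a GRing.unit].

Definition local_ring : Prop := idealr_closed nonunits.

Definition has_depth (d : nat) : Prop :=
  (exists s : seq A, [/\ size s = d, {subset s <= nonunits} & regular_seq s]) /\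
  (forall s : seq A, {subset s <= nonunits} -> regular_seq s -> (size s <= d)%N).

Definition cohen_macaulay_local : Prop :=
  [/\ local_ring, noetherian A & exists d : nat, has_depth d /\ has_krull_dim A d].

End CohenMacaulayLocal.

Section Localization.

Variables (A : idomainType) (P : prime_idealr A).

Definition localization_pred : {pred {fraction A}} :=
  fun x => `[< exists a s : A, s \notin P /\ x = tofrac a / tofrac s >].

Fact localization_subring : subring_closed localization_pred.
Proof.
have P0 : 0 \in P := rpred0 P.
have P1 : 1 \notin P by rewrite idealr1.
have nz s : s \notin P -> tofrac s != 0.
  by move=> sP; rewrite tofrac_eq0; apply: contraNneq sP => ->.
split.
- by apply/asboolP; exists 1, 1; rewrite rmorph1 divr1.
- move=> _ _ /asboolP[a [s [sP ->]]] /asboolP[b [t [tP ->]]]; apply/asboolP.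
  exists (a * t - b * s), (s * t); split.
    by rewrite prime_idealrM negb_or sP.
  by rewrite -mulNr addf_div ?nz // rmorphB !rmorphM mulNr.
- move=> _ _ /asboolP[a [s [sP ->]]] /asboolP[b [t [tP ->]]]; apply/asboolP.
  exists (a * b), (s * t); split; first by rewrite prime_idealrM negb_or sP.
  by rewrite !rmorphM /= mulf_div.
Qed.

HB.instance Definition _ :=
  GRing.isSubringClosed.Build {fraction A} localization_pred
    localization_subring.

Definition localization : idomainType := subdomain localization_pred.

End Localization.

(* Maximal ideals are prime, so ranging over [prime_idealr A], which
   [localization] requires, excludes none of them. *)
Definition cohen_macaulay (A : idomainType) : Prop :=
  noetherian A /\
  forall P : prime_idealr A, maximal_ideal P ->
  cohen_macaulay_local (localization P).

Definition integrally_closed (A : idomainType) : Prop :=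
  forall x : {fraction A}, integralOver (@tofrac A) x ->
  exists a : A, x = tofrac a.

Inductive subalgebra_gen (k B : nzRingType) (f : k -> B) (X : B -> Prop) :
    B -> Prop :=
| subalgebra_gen_scalar c : subalgebra_gen f X (f c)
| subalgebra_gen_mem x : X x -> subalgebra_gen f X x
| subalgebra_gen_add x y :
    subalgebra_gen f X x -> subalgebra_gen f X y -> subalgebra_gen f X (x + y)
| subalgebra_gen_mul x y :
    subalgebra_gen f X x -> subalgebra_gen f X y -> subalgebra_gen f X (x * y).

Section RV.

Variables (F : finFieldType) (V : vectType F).

(* The symmetric algebra, modelled as the polynomial ring in the coordinates
   of V; [SymV_universal] is its universal property. *)
Definition SymV : idomainType := {mpoly F[\dim {:V}]}.

HB.instance Definition _ := GRing.ComAlgebra.on SymV.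

Definition symV (v : V) : SymV :=
  \sum_(i < \dim {:V}) coord (vbasis {:V}) i v *: 'X_i.

Fact symV_is_linear : linear symV.
Proof.
move=> a u v; rewrite /symV scaler_sumr -big_split /=; apply: eq_bigr => i _.
by rewrite linearP scalerDl scalerA.
Qed.

HB.instance Definition _ :=
  GRing.isLinear.Build F V SymV _ symV symV_is_linear.

Section Universal.

Variables (B : comAlgType F) (f : {linear V -> B}).

Definition symV_lift (p : SymV) : B :=
  mmap (in_alg B) (fun i => f (vbasis {:V})`_i) p.

Fact symV_lift_is_linear : linear symV_lift.
Proof.
by move=> a p q; rewrite /symV_lift raddfD /= mmapZ /= mulr_algl.
Qed.

HB.instance Definition _ :=
  GRing.isLinear.Build F SymV B _ symV_lift symV_lift_is_linear.

Fact symV_lift_is_monoid_morphism : monoid_morphism symV_lift.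
Proof. by split; [exact: rmorph1 | exact: rmorphM]. Qed.

HB.instance Definition _ :=
  GRing.isMonoidMorphism.Build SymV B symV_lift symV_lift_is_monoid_morphism.

Lemma SymV_universal :
  exists g : {lrmorphism SymV -> B},
    (forall v, g (symV v) = f v) /\
    (forall h : {lrmorphism SymV -> B},
       (forall v, h (symV v) = f v) -> forall p, h p = g p).
Proof.
have symV_basis (i : 'I_(\dim {:V})) : symV (vbasis {:V})`_i = 'X_i.
  rewrite /symV (bigD1 i) //= big1 => [|j ji].
    by rewrite coord_free ?eqxx ?scale1r ?addr0 // (basis_free (vbasisP _)).
  rewrite coord_free ?(basis_free (vbasisP _)) //.
  by rewrite eq_sym (negPf ji) scale0r.
exists symV_lift; split=> [v|h hf p].
  rewrite {2}(coord_vbasis (memvf v)) /symV !linear_sum; apply: eq_bigr => i _.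
  rewrite !linearZ /=; congr (_ *: _).
  by rewrite /symV_lift mmapX mmap1U.
rewrite (mpolyE (p : {mpoly F[_]})) !linear_sum; apply: eq_bigr => m _.
rewrite !linearZ /=; congr (_ *: _).
rewrite mpolyXE_id !rmorph_prod; apply: eq_bigr => i _.
rewrite !rmorphXn -symV_basis; congr (_ ^+ _); apply: etrans (hf _) _.
by rewrite symV_basis /= /symV_lift mmapX mmap1U.
Qed.

End Universal.

Definition KV : fieldType := {fraction SymV}.

Definition RV_pred : {pred KV} :=
  fun x => `[< subalgebra_gen (fun c : F => tofrac (c%:A : SymV))
                 (fun y => exists2 v : V, v != 0 & y = (tofrac (symV v))^-1) x >].

Fact RV_subring : subring_closed RV_pred.
Proof.
have sc (c : F) : tofrac (c%:A : SymV) \in RV_pred.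
  exact/asboolP/subalgebra_gen_scalar.
have clM : {in RV_pred &, forall x y, x * y \in RV_pred}.
  by move=> x y /asboolP xR /asboolP yR; apply/asboolP/subalgebra_gen_mul.
split=> //.
- by have := sc 1; rewrite scale1r rmorph1.
- move=> x y xR yR; rewrite -mulN1r.
  have N1 : -1 \in RV_pred by have := sc (-1); rewrite scaleN1r rmorphN1.
  by apply/asboolP/subalgebra_gen_add; apply/asboolP => //; apply: clM.
Qed.

HB.instance Definition _ := GRing.isSubringClosed.Build KV RV_pred RV_subring.

Definition RV : idomainType := subdomain RV_pred.

End RV.

(* Main.v *)
Require Import Defs.
From HB Require Import structures.
From mathcomp Require Import all_boot all_order all_algebra.
From mathcomp Require Import ring zify mpoly boolp classical_sets.

Set Implicit Arguments.
Unset Strict Implicit.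
Unset Printing Implicit Defensive.

Import GRing.Theory.

Local Open Scope ring_scope.

(** Adjoin the vectors of a basis of [V] one at a time. If [B] is the ring generated by the
inverses of the nonzero vectors of a subspace [W], and [C] the ring for [W] plus the line of a
new vector [t], then up to scalars the new generators are the polar parts 1 / (t + w) with [w]
in [W]. A product of two distinct polar parts is a [B]-combination of the two, so partial
fractions show that [C] is a free module over [B[theta]], where [theta] is the sum of all polar
parts, with basis 1 and the polar parts with [w <> 0] ([polar_comb_span], [polar_comb_free]).
Hence [R_V] is free of finite rank over a polynomial ring in [dim V] variables. Both properties
are proved along this tower.

Cohen-Macaulayness: fix any prime [Q] of [R_V], and look at each step [B], [C]. Either [theta]
satisfies an equation modulo [Q] over [B] whose leading coefficient is outside [Q]; by freeness,
the value of this equation at [theta] is then regular modulo all previous elements, locally at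
[Q], and it is appended to a regular sequence [s] in [Q]. Or [theta] is transcendental modulo [Q]
over [B], and it is added to a family [y] that is algebraically independent modulo [Q]
([prime_parameters_extend]). In the end the sizes of [s] and [y] add up to [dim V]. If
P_0 < ... < P_n is a chain of primes contained in [Q] and x_i is in P_i but not in P_(i-1), then
x_1, ..., x_n together with [y] are algebraically independent ([independent_mod_chain]). As
[R_V] lies in a field of transcendence degree [dim V], it follows that [n] is at most the size
of [s]; the base field being finite, this bound on independent families is a matter of counting
polynomials ([independent_size]). Conversely a regular sequence of length [n] always cuts out a
chain of [n + 1] primes ([regular_seq_chain]). So depth and dimension of the localization at [Q]
both equal the size of [s].

Normality: complete integral closedness passes from [B] to [C]. If [d <> 0] and all
[d * x ^+ n] are in [C], the leading coefficient of [x] at a pole [t = - w] has the same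
property with respect to [B], because the elements of [C] have principal parts with coefficients
in [B] ([principal_part]); so it is in [B], and subtracting its polar term from [x] lowers the
degree of the denominator ([almost_integral_frac]).

Noetherianity is Hilbert's basis theorem, [R_V] being a finitely generated algebra. *)

(** * Ideals, primes and regular sequences *)

Section Ideals.

Variable R : comNzRingType.
Implicit Types (s : seq R) (x y : R) (I S : R -> Prop).

(** Improper ideals are included, unlike in [idealr_closed]. *)
Definition ideal I : Prop :=
  [/\ I 0, forall x y, I x -> I y -> I (x + y) & forall a x, I x -> I (a * x)].

Lemma span_ideal_ideal s : ideal (span_ideal s).
Proof.
split.
- by exists (fun=> 0); rewrite big1 // => i _; rewrite mul0r.
- move=> x y [c ->] [d ->]; exists (fun i => c i + d i).
  by rewrite -big_split; apply: eq_bigr => i _; rewrite mulrDl.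
- move=> a x [c ->]; exists (fun i => a * c i).
  by rewrite mulr_sumr; apply: eq_bigr => i _; rewrite mulrA.
Qed.

Lemma ideal_sum I (J : finType) (P : pred J) (f : J -> R) :
  ideal I -> (forall j, P j -> I (f j)) -> I (\sum_(j | P j) f j).
Proof. by move=> [I0 ID _] If; apply: big_ind. Qed.

Lemma span_ideal_sub s I :
  ideal I -> (forall x, x \in s -> I x) -> forall x, span_ideal s x -> I x.
Proof.
move=> idI sI _ [c ->]; apply: ideal_sum => // i _.
by case: idI => _ _; apply; apply/sI/mem_nth.
Qed.

Lemma mem_span_ideal s x : x \in s -> span_ideal s x.
Proof.
move=> xs; have sz : (index x s < size s)%N by rewrite index_mem.
exists (fun i => (i == Ordinal sz)%:R).
rewrite (bigD1 (Ordinal sz)) //= eqxx mul1r nth_index // big1 ?addr0 // => i.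
by move=> /negPf ->; rewrite mul0r.
Qed.

Lemma span_ideal_mono s1 s2 x :
  {subset s1 <= s2} -> span_ideal s1 x -> span_ideal s2 x.
Proof.
move=> s12; apply: span_ideal_sub; first exact: span_ideal_ideal.
by move=> y /s12; apply: mem_span_ideal.
Qed.

(** Krull's separation lemma: an ideal containing [I] that is maximal among those disjoint
from the multiplicative set [S] is prime. *)
Lemma exists_prime_disjoint I S :
    ideal I -> S 1 -> (forall x y, S x -> S y -> S (x * y)) ->
    (forall x, I x -> ~ S x) ->
  exists P : prime_idealr R,
    (forall x, I x -> x \in P) /\ (forall x, S x -> x \notin P).
Proof.
move=> idI S1 SM IS.
pose good (A : set R) := [/\ ideal A, (I `<=` A)%classic & forall x, A x -> ~ S x].
pose GP (A : set R) := A = set0 \/ good A.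
have [A [[A0|[idA IA AS]] maxA]] : exists A, GP A /\ forall B, (A `<` B)%classic -> ~ GP B.
- apply: Zorn_bigcup => F FP Ftot.
  have [[A0 [FA0 gA0]]|noF] := pselect (exists A, F A /\ good A); last first.
    left; apply/seteqP; split=> // x [A FA Ax]; case: (FP _ FA) => [A0|gA].
      by move: Ax; rewrite A0.
    by apply: noF; exists A.
  right; split.
  + split; first by exists A0 => //; case: gA0 => -[].
    * move=> x y [A FA Ax] [B FB By].
      have gA : good A by case: (FP _ FA) => // A0'; move: Ax; rewrite A0'.
      have gB : good B by case: (FP _ FB) => // A0'; move: By; rewrite A0'.
      have [AB|BA] := Ftot _ _ FA FB.
        by exists B => //; case: gB => -[_ D _] _ _; apply: D => //; apply: AB.
      by exists A => //; case: gA => -[_ D _] _ _; apply: D => //; apply: BA.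
    * move=> a x [A FA Ax]; exists A => //.
      by case: (FP _ FA) => [A0'|[[_ _ M] _ _]]; [move: Ax; rewrite A0'|apply: M].
  + by move=> x Ix; case: (gA0) => _ IA _; exists A0 => //; apply: IA.
  + move=> x [A FA Ax]; case: (FP _ FA) => [A0'|[_ _ AS]]; last exact: AS.
    by move: Ax; rewrite A0'.
- exfalso; apply: (maxA I); last by right; split.
  by split; [rewrite A0|move=> /(_ 0); rewrite A0; apply; case: idI].
have [A00 AD AM] := idA.
(* an element outside [A] has a multiple meeting [S] modulo [A] *)
have meet u : ~ A u -> exists a b, A a /\ S (a + b * u).
  move=> nAu; apply: contrapT => no.
  pose B : set R := fun x => exists a b, A a /\ x = a + b * u.
  apply: (maxA B).
    split=> [x Ax|/(_ u)]; first by exists x, 0; rewrite mul0r addr0.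
    by move=> BA; apply/nAu/BA; exists 0, 1; rewrite mul1r add0r.
  right; split.
  + split; first by exists 0, 0; rewrite mul0r addr0.
    * move=> _ _ [a [b [Aa ->]]] [c [d [Ac ->]]]; exists (a + c), (b + d).
      by split; [exact: AD|rewrite mulrDl addrACA].
    * move=> r _ [a [b [Aa ->]]]; exists (r * a), (r * b).
      by split; [exact: AM|rewrite mulrDr mulrA].
  + by move=> x Ix; exists x, 0; split; [exact: IA|rewrite mul0r addr0].
  + by move=> _ [a [b [Aa ->]]] Sab; apply: no; exists a, b.
pose P : {pred R} := fun x => `[< A x >].
have Pid : idealr_closed P.
  split; first exact/asboolP.
  + by apply/asboolP => /AS.
  + by move=> a u v /asboolP Au /asboolP Av; apply/asboolP/AD => //; apply: AM.
have Ppr : prime_idealr_closed P.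
  move=> u v /asboolP Auv; have [//|/asboolPn nAu] := boolP (u \in P).
  have [//|/asboolPn nAv] := boolP (v \in P); exfalso.
  have [a [b [Aa S1']]] := meet _ nAu; have [c [d [Ac S2]]] := meet _ nAv.
  apply: (AS ((a + b * u) * (c + d * v))); last exact: SM.
  rewrite mulrDl !mulrDr; apply: (AD); apply: (AD).
  + exact: AM.
  + by rewrite mulrC; apply: AM.
  + exact: AM.
  + by rewrite mulrACA; apply: AM.
pose PH1 := isIdealr.Build R P Pid.
pose PH2 := isPrimeIdealrClosed.Build R P Ppr.
pose PP : prime_idealr R := HB.pack P PH1 PH2.
exists PP; split=> x; first by move=> Ix; apply/asboolP/IA.
by move=> Sx; apply/asboolPn => /AS.
Qed.

(** A regular sequence inside a prime cuts out a chain of primes: as [s`_k] is regular modulo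
the previous terms, the powers of [s`_k] times elements outside [q] avoid those terms. *)
Lemma regular_seq_chain_below s : regular_seq s ->
  forall (k : nat) (q : prime_idealr R), (k <= size s)%N ->
  (forall x, x \in take k s -> x \in q) ->
  exists P : 'I_k.+1 -> prime_idealr R, prime_chain P /\ P ord_max = q.
Proof.
move=> [reg _]; elim=> [|k IH] q ks sq.
  by exists (fun=> q); split=> // i j; rewrite !ord1.
have tk : take k.+1 s = rcons (take k s) s`_k by rewrite (take_nth 0).
have skq : s`_k \in q by apply: sq; rewrite tk mem_rcons inE eqxx.
have idq : ideal (fun x => x \in q).
  split; first exact: rpred0; first by move=> x y; exact: rpredD.
  by move=> a x; exact: idealMr.
pose S x := exists n u, u \notin q /\ x = s`_k ^+ n * u.
have [q' [Iq' Sq']] : exists P : prime_idealr R,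
    (forall x, span_ideal (take k s) x -> x \in P) /\ (forall x, S x -> x \notin P).
  apply: exists_prime_disjoint.
  - exact: span_ideal_ideal.
  - by exists 0, 1; rewrite mulr1 idealr1.
  - move=> _ _ [n [u [uq ->]]] [m [v [vq ->]]]; exists (n + m)%N, (u * v).
    by rewrite prime_idealrM negb_or uq vq exprD mulrACA.
  - move=> x Ix [n [u [/negP uq xE]]]; apply: uq; move: Ix; rewrite {}xE.
    elim: n => [|n IHn]; last by rewrite exprS -mulrA => /reg; move=> /(_ ks).
    rewrite mul1r; apply: (span_ideal_sub idq) => y yk.
    by apply: sq; rewrite tk mem_rcons inE yk orbT.
have q'q x : x \in q' -> x \in q.
  apply: contraLR => xq; apply: Sq'; exists 0, x; rewrite mul1r; split=> //.
have skq' : s`_k \notin q'.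
  by apply: Sq'; exists 1, 1; rewrite mulr1 idealr1.
have [|P [Pch Pmax]] := IH q' (ltnW ks).
  by move=> x xs; apply/Iq'/mem_span_ideal.
exists (fun i => if (i < k.+1)%N then P (inord i) else q); split; last by rewrite ltnn.
have Pq (i : 'I_k.+1) x : x \in P i -> x \in q'.
  have [ik|] := ltnP i k; last first.
    move=> ki; rewrite -Pmax; suff -> : i = ord_max by [].
    by apply/val_inj/eqP; rewrite /= eqn_leq ki andbT -ltnS ltn_ord.
  by have [+ _] := Pch i ord_max ik; rewrite Pmax => h /h.
move=> i j ij /=; case: (ltnP j k.+1) => jk.
  rewrite (ltn_trans ij jk); apply: Pch; rewrite !inordK //.
  exact: ltn_trans ij jk.
have ik : (i < k.+1)%N.
  by apply: leq_trans ij _; rewrite -ltnS.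
rewrite ik; split=> [x /Pq /q'q//|/(_ _ skq) /Pq].
by rewrite (negPf skq').
Qed.

Lemma regular_seq_chain s : regular_seq s ->
  exists P : 'I_(size s).+1 -> prime_idealr R, prime_chain P.
Proof.
move=> reg; have [q [sq _]] : exists P : prime_idealr R,
    (forall x, span_ideal s x -> x \in P) /\ (forall x, x = 1 -> x \notin P).
  apply: exists_prime_disjoint => //; first exact: span_ideal_ideal.
    by move=> x y -> ->; rewrite mulr1.
  by move=> x sx x1; case: reg => _; apply; rewrite -x1.
have [|P [Pch _]] := @regular_seq_chain_below s reg (size s) q (leqnn _).
  by move=> x; rewrite take_size => xs; apply/sq/mem_span_ideal.
by exists P.
Qed.

End Ideals.

(** * Noetherian rings and localizations *)

Section Noetherian.

Lemma noetherianP (R : comNzRingType) :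
  noetherian R <->
  forall I : R -> Prop, ideal I ->
    exists s : seq R, (forall x, x \in s -> I x) /\ forall x, I x -> span_ideal s x.
Proof.
split=> [noethR I [I0 ID IM]|fgR I [I0 _ IDM]].
- have [I1|nI1] := pselect (I 1).
    exists [:: 1]; split=> [x|x _]; first by rewrite inE => /eqP ->.
    by exists (fun=> x); rewrite big_ord1 mulr1.
  have [|s sI] := noethR (fun x => `[< I x >]).
    split; first exact/asboolP; first exact/asboolPn.
    by move=> a u v /asboolP Iu /asboolP Iv; apply/asboolP/ID => //; apply: IM.
  exists s; split=> x; last by move=> Ix; apply/sI/asboolP.
  by move=> /mem_span_ideal/sI/asboolP.
- have idI : ideal (fun x => x \in I).
    split=> // [x y Ix Iy|a x Ix]; first by rewrite -[x]mul1r IDM.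
    by rewrite -[_ * _]addr0 IDM.
  have [s [sI Is]] := fgR _ idI; exists s => x; split; first exact: Is.
  exact: (span_ideal_sub idI sI).
Qed.

Lemma noetherian_field (k : fieldType) : noetherian k.
Proof.
apply/noetherianP => I [I0 ID IM].
have [[x [Ix x0]]|no] := pselect (exists x, I x /\ x != 0).
  exists [:: x]; split=> [y|y _]; first by rewrite inE => /eqP ->.
  by exists (fun=> y / x); rewrite big_ord1 divfK.
exists [::]; split=> // x Ix; exists (fun=> 0); rewrite big_ord0.
by apply/eqP; apply: contra_notT no => x0; exists x.
Qed.

Lemma noetherian_surj (R S : comNzRingType) (f : {rmorphism R -> S}) :
  (forall y, exists x, f x = y) -> noetherian R -> noetherian S.
Proof.
move=> fsurj /noetherianP nR; apply/noetherianP => I [I0 ID IM].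
have [|s [sI Is]] := nR (fun x => I (f x)).
  split; first by rewrite rmorph0.
  - by move=> x y Ix Iy; rewrite rmorphD; apply: ID.
  - by move=> a x Ix; rewrite rmorphM; apply: IM.
exists (map f s); split=> [_ /mapP[x xs ->]|y Iy]; first exact: sI.
have [x xE] := fsurj y; move: Iy; rewrite -xE => /Is[c ->].
rewrite rmorph_sum; apply: ideal_sum; first exact: span_ideal_ideal.
move=> i _; rewrite rmorphM; case: (span_ideal_ideal (map f s)) => _ _; apply.
by apply/mem_span_ideal/map_f/mem_nth.
Qed.

(** Hilbert's basis theorem, by leading coefficients: those of the elements of degree [n] of
an ideal form an increasing sequence of ideals of [A], which is stationary. *)
Lemma noetherian_poly (A : comNzRingType) : noetherian A -> noetherian {poly A}.
Proof.
move=> /noetherianP nA; apply/noetherianP => I idI; have [I0 ID IM] := idI.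
pose L n c := exists f : {poly A}, [/\ I f, (size f <= n.+1)%N & f`_n = c].
have idL n : ideal (L n).
  split; first by exists 0; rewrite size_poly0 coef0.
  - move=> _ _ [f [If sf <-]] [g [Ig sg <-]]; exists (f + g); split.
    + exact: ID.
    + by rewrite (leq_trans (size_polyD _ _)) // geq_max sf.
    + by rewrite coefD.
  - move=> a _ [f [If sf <-]]; exists (a%:P * f); split; first exact: IM.
    + by rewrite mul_polyC (leq_trans (size_scale_leq _ _)).
    + by rewrite coefCM.
have shift n m (f : {poly A}) : (n <= m)%N -> (size f <= n.+1)%N ->
    (size ('X^(m - n) * f)%R <= m.+1)%N /\ ('X^(m - n) * f)`_m = f`_n.
  move=> nm sf; rewrite coefXnM ltnNge leq_subr /= subKn //; split=> //.
  apply: leq_trans (size_polyMleq _ _) _; rewrite size_polyXn addSn /=.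
  by rewrite -(leq_add2l (m - n)) addnS subnK // in sf.
have LX n m c : (n <= m)%N -> L n c -> L m c.
  move=> nm [f [If sf <-]]; have [sX cX] := shift n m f nm sf.
  by exists ('X^(m - n) * f); split=> //; apply: IM.
have lift n : exists t : seq {poly A}, (forall f, f \in t -> I f) /\
    forall c, L n c -> exists g, [/\ span_ideal t g, (size g <= n.+1)%N & g`_n = c].
  have [s [sL Ls]] := nA _ (idL n).
  have /choice[F FP] c : exists f : {poly A},
      L n c -> [/\ I f, (size f <= n.+1)%N & f`_n = c].
    by have [[f fP]|] := pselect (L n c); [exists f|exists 0].
  exists (map F s); split=> [_ /mapP[x xs ->]|c]; first by case: (FP x (sL x xs)).
  move=> /Ls[a ->]; exists (\sum_(i < size s) (a i)%:P * F s`_i); split.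
  - apply: ideal_sum; first exact: span_ideal_ideal.
    move=> i _; case: (span_ideal_ideal (map F s)) => _ _; apply.
    exact/mem_span_ideal/map_f/mem_nth.
  - apply: (leq_trans (size_sum _ _ _)); apply/bigmax_leqP => i _.
    rewrite mul_polyC (leq_trans (size_scale_leq _ _)) //.
    by case: (FP _ (sL _ (mem_nth 0 (ltn_ord i)))).
  - rewrite coef_sum; apply: eq_bigr => i _; rewrite coefCM.
    by case: (FP _ (sL _ (mem_nth 0 (ltn_ord i)))) => _ _ ->.
have [N LN] : exists N, forall n c, L n c -> L N c.
  have [|s [sL Ls]] := nA (fun c => exists n, L n c).
    split; first by exists 0; case: (idL 0).
    - move=> x y [n Lx] [m Ly]; exists (maxn n m); case: (idL (maxn n m)) => _ D _.
      by apply: D; [apply: LX Lx; rewrite leq_maxl|apply: LX Ly; rewrite leq_maxr].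
    - by move=> a x [n Lx]; exists n; case: (idL n) => _ _; apply.
  have [N NP] : exists N, forall x, x \in s -> L N x.
    elim: s sL {Ls} => [|x s IH] sL; first by exists 0.
    have [n Lx] := sL x (mem_head _ _).
    have [|m Lm] := IH; first by move=> y ys; apply: sL; rewrite inE ys orbT.
    exists (maxn n m) => y; rewrite inE => /orP[/eqP ->|/Lm].
      by apply: LX Lx; rewrite leq_maxl.
    by apply: LX; rewrite leq_maxr.
  exists N => n c Lc; apply: (span_ideal_sub (idL N) NP).
  by apply: Ls; exists n.
have /choice[T TP] := lift.
pose t := flatten [seq T n | n <- iota 0 N.+1].
have Tt n : (n <= N)%N -> {subset T n <= t}.
  by move=> nN f fT; apply/flattenP; exists (T n) => //; apply: map_f; rewrite mem_iota.
exists t; split.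
  by move=> f /flattenP[_ /mapP[n _ ->]]; case: (TP n) => + _; apply.
have [t0 tD tM] := span_ideal_ideal t.
suff gen m f : I f -> (size f <= m)%N -> span_ideal t f by move=> f If; apply: gen If _.
elim: m f => [|m IH] f If; first by rewrite leqn0 size_poly_eq0 => /eqP ->.
move=> sf; have Lm : L m f`_m by exists f.
have [g [tg sg gm]] : exists g, [/\ span_ideal t g, (size g <= m.+1)%N & g`_m = f`_m].
  have [mN|/ltnW Nm] := leqP m N.
    have [g [Tg sg gm]] := (TP m).2 _ Lm.
    by exists g; split=> //; apply: span_ideal_mono Tg; apply: Tt.
  have [g [Tg sg gm]] := (TP N).2 _ (LN _ _ Lm); have [sX cX] := shift N m g Nm sg.
  exists ('X^(m - N) * g); split; [|exact: sX|by rewrite cX].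
  by apply: tM; apply: span_ideal_mono Tg; apply: Tt.
have tI h : span_ideal t h -> I h.
  apply: span_ideal_sub => // x /flattenP[_ /mapP[n _ ->]].
  by case: (TP n) => + _; apply.
rewrite -(subrK g f); apply: (tD) => //; apply: IH.
  by apply: ID => //; rewrite -mulN1r; apply: IM; apply: tI.
apply/leq_sizeP => j; rewrite leq_eqVlt => /orP[/eqP <-|mj].
  by rewrite coefB gm subrr.
by rewrite coefB !nth_default ?subrr // (leq_trans _ mj).
Qed.

(** Surjections from iterated polynomial rings, in a form suited to induction on the generators:
it asks only that scalars and generators be reached. *)
Lemma finitely_generated_cover (k : fieldType) (A : comNzRingType)
    (phi : {rmorphism k -> A}) (s : seq A) :
  exists (B : comNzRingType) (f : {rmorphism B -> A}),
    [/\ noetherian B, forall c, exists b, f b = phi c &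
        forall x, x \in s -> exists b, f b = x].
Proof.
elim: s => [|x s [B [f [nB phiB sB]]]].
  exists k, phi; split=> //; first exact: noetherian_field.
  by move=> c; exists c.
have cfx : commr_rmorph f x by move=> b; exact: mulrC.
exists {poly B}, (horner_morph cfx); split; first exact: noetherian_poly.
  by move=> c; have [b <-] := phiB c; exists b%:P; exact: horner_morphC.
move=> y; rewrite inE => /orP[/eqP ->|/sB[b <-]].
  by exists 'X; exact: horner_morphX.
by exists b%:P; exact: horner_morphC.
Qed.

End Noetherian.

Section LocalizationTheory.

Variables (A : idomainType) (P : prime_idealr A).

Fact loc_embed_subproof (a : A) : tofrac a \in localization_pred P.
Proof. by apply/asboolP; exists a, 1; rewrite idealr1 rmorph1 divr1. Qed.

Definition loc_embed (a : A) : localization P := SubDomain (loc_embed_subproof a).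

Fact loc_embed_zmod : zmod_morphism loc_embed.
Proof. by move=> a b; apply: val_inj; rewrite rmorphB /= rmorphB. Qed.

Fact loc_embed_monoid : monoid_morphism loc_embed.
Proof.
split; first by apply: val_inj; rewrite rmorph1 /= rmorph1.
by move=> a b; apply: val_inj; rewrite rmorphM /= rmorphM.
Qed.

HB.instance Definition _ :=
  GRing.isZmodMorphism.Build A (localization P) loc_embed loc_embed_zmod.
HB.instance Definition _ :=
  GRing.isMonoidMorphism.Build A (localization P) loc_embed loc_embed_monoid.

Lemma loc_embed_inj : injective loc_embed.
Proof. by move=> a b /(congr1 val) /= /eqP; rewrite tofrac_eq => /eqP. Qed.

Lemma tofrac_neq0 s : s \notin P -> tofrac s != 0 :> {fraction A}.
Proof. by rewrite tofrac_eq0; apply: contraNneq => ->; exact: rpred0. Qed.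

Lemma localizationP (x : localization P) :
  exists a s, s \notin P /\ x * loc_embed s = loc_embed a.
Proof.
have /asboolP[a [s [sP xE]]] := valP x; exists a, s; split=> //.
by apply: val_inj; rewrite rmorphM /= xE divfK // tofrac_neq0.
Qed.

Lemma loc_embed_unit s : (loc_embed s \is a GRing.unit) = (s \notin P).
Proof.
apply/idP/idP => [sU|sP].
  have [a [t [tP]]] := localizationP (loc_embed s)^-1.
  move=> /(congr1 (fun z => loc_embed s * z)); rewrite mulrA divrr // mul1r -rmorphM.
  by move=> /loc_embed_inj tE; move: tP; rewrite tE prime_idealrM negb_or => /andP[].
apply/unitrPr.
have sV : (tofrac s)^-1 \in localization_pred P.
  by apply/asboolP; exists 1, s; rewrite rmorph1 mul1r.
exists (SubDomain sV); apply: val_inj; rewrite rmorphM rmorph1 /=.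
by rewrite divff // tofrac_neq0.
Qed.

Lemma localization_local : local_ring (localization P).
Proof.
have nonunitE (x : localization P) a s :
    s \notin P -> x * loc_embed s = loc_embed a -> (x \in @nonunits (localization P)) = (a \in P).
  move=> sP xE; rewrite inE -[a \in P]negbK -loc_embed_unit -xE unitrM.
  by rewrite loc_embed_unit sP andbT.
split.
- by rewrite inE unitr0.
- by rewrite inE unitr1.
- move=> x u v.
  have [a [s [sP xE]]] := localizationP x; have [b [t [tP uE]]] := localizationP u.
  have [c [r [rP vE]]] := localizationP v.
  rewrite (nonunitE u b t tP uE) (nonunitE v c r rP vE) => bP cP.
  rewrite (nonunitE _ (a * b * r + c * (s * t)) (s * t * r)).
  + by apply: rpredD; rewrite ?[_ * r]mulrC ?[c * _]mulrC !idealMr.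
  + by rewrite !prime_idealrM !negb_or sP tP.
  + have -> : loc_embed (a * b * r + c * (s * t)) =
        loc_embed a * loc_embed b * loc_embed r + loc_embed c * (loc_embed s * loc_embed t).
      by rewrite rmorphD !rmorphM.
    by rewrite !rmorphM -xE -uE -vE /=; ring.
Qed.

Lemma noetherian_localization : noetherian A -> noetherian (localization P).
Proof.
move=> /noetherianP nA; apply/noetherianP => I [I0 ID IM].
have [|s [sI Is]] := nA (fun x => I (loc_embed x)).
  split; first by rewrite rmorph0.
  - by move=> x y Ix Iy; rewrite rmorphD; apply: ID.
  - by move=> a x Ix; rewrite rmorphM; apply: IM.
exists (map loc_embed s); split=> [_ /mapP[x xs ->]|y Iy]; first exact: sI.
have [a [t [tP yE]]] := localizationP y.
have tU : loc_embed t \is a GRing.unit by rewrite loc_embed_unit.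
rewrite -(mulrK tU y) yE mulrC; case: (span_ideal_ideal (map loc_embed s)) => s0 sD sM.
apply: (sM); have /Is[c ->] : I (loc_embed a) by rewrite -yE mulrC; apply: IM.
rewrite rmorph_sum; apply: ideal_sum; first exact: span_ideal_ideal.
move=> i _; rewrite rmorphM; apply: sM.
by apply/mem_span_ideal/map_f/mem_nth.
Qed.

End LocalizationTheory.

(** * Algebraic independence modulo a prime *)

Section Independence.

Variable F : finFieldType.

(** The polynomials in [n] variables over [F] with all exponents below [m], as a finite type so
that they can be counted; [box_eval] evaluates them, the head of the list being the outer
variable. *)
Fixpoint poly_box (m n : nat) : finType :=
  if n is n'.+1 then {ffun 'I_m -> poly_box m n'} else F.

Fixpoint box_eval (R : comNzRingType) (phi : F -> R) (m n : nat) (l : seq R) :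
    poly_box m n -> R :=
  if n is n'.+1 return poly_box m n -> R then
    fun c : {ffun 'I_m -> poly_box m n'} =>
      \sum_(j < m) head 0 l ^+ j * box_eval phi (behead l) (c j)
  else phi.

Definition independent_mod (R : comNzRingType) (phi : F -> R) (Q : {pred R}) (l : seq R) :=
  forall m (c d : poly_box m (size l)), c != d -> box_eval phi l c - box_eval phi l d \notin Q.

Lemma card_poly_box m n : #|{: poly_box m n}| = (#|F| ^ (m ^ n))%N.
Proof.
elim: n => [|n IH] /=; first by rewrite expn0 expn1.
by rewrite card_ffun IH card_ord -expnM expnS mulnC.
Qed.

Lemma box_eval_map (R S : comNzRingType) (f : {rmorphism R -> S}) (phi : F -> R)
    m n l (c : poly_box m n) :
  box_eval (f \o phi) (map f l) c = f (box_eval phi l c).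
Proof.
elim: n l c => [|n IH] l c //=; rewrite rmorph_sum; apply: eq_bigr => j _.
rewrite rmorphM rmorphXn -IH; case: l => [|x l] //=; first by rewrite rmorph0.
Qed.

(** Expanding a difference of two values in powers of [x], its lowest coefficient is a
difference of values of the remaining elements modulo [Q]; factors [x] cancel modulo [Q']. *)
Lemma independent_mod_cons (R : comNzRingType) (phi : F -> R) (Q Q' : prime_idealr R) x l :
  {subset Q' <= Q} -> x \in Q -> x \notin Q' ->
  independent_mod phi Q l -> independent_mod phi Q' (x :: l).
Proof.
move=> Q'Q xQ xQ' ind m; rewrite /= => c d cd.
set e := box_eval phi l.
have sumE : \sum_(j < m) x ^+ j * e (c j) - \sum_(j < m) x ^+ j * e (d j) =
            \sum_(j < m) x ^+ j * (e (c j) - e (d j)).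
  by rewrite -sumrB; apply: eq_bigr => j _; rewrite mulrBr.
rewrite sumE; have [j cdj jmin] : exists2 j : 'I_m, c j != d j &
    forall i : 'I_m, (i < j)%N -> c i = d i.
  have /existsP[j0 cd0] : [exists j, c j != d j].
    rewrite -negb_forall; apply: contra cd => /forallP cd.
    by apply/eqP/ffunP => j; apply/eqP.
  have [j cdj jmin] := @arg_minnP _ j0 (fun j => c j != d j) val cd0.
  exists j => // i ij; apply/eqP; apply: contraTT ij => cdi.
  by rewrite -leqNgt jmin.
have xj i : (\sum_(k < m) x ^+ k * (e (c k) - e (d k))) = x ^+ j *
   ((e (c j) - e (d j)) + i) -> i \in Q ->
   \sum_(k < m) x ^+ k * (e (c k) - e (d k)) \notin Q'.
  move=> -> iQ; rewrite prime_idealrM negb_or; apply/andP; split.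
    elim: (j : nat) => [|k IH]; first by rewrite idealr1.
    by rewrite exprS prime_idealrM negb_or xQ'.
  apply: contra (ind _ _ _ cdj) => /Q'Q.
  by rewrite -/e => h; rewrite -(addrK i (_ - _)) rpredB.
apply: (xj (\sum_(k < m | (j < k)%N) x ^+ (k - j) * (e (c k) - e (d k)))); last first.
  apply: rpred_sum => k jk; rewrite mulrC idealMr //.
  by rewrite -(subnSK jk) exprS mulrC idealMr.
rewrite mulrDr mulr_sumr (bigD1 j) //=; congr (_ + _).
rewrite (bigID (fun k : 'I_m => (j < k)%N)) /= [X in _ + X]big1 ?addr0.
  apply: eq_big => [k|k /andP[_ jk]].
    by have [->|] := eqVneq k j; rewrite ?ltnn ?andbT.
  by rewrite mulrA -exprD subnKC // ltnW.
move=> k /andP[kj]; rewrite -leqNgt leq_eqVlt => /orP[/eqP/val_inj kE|/jmin ->].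
  by rewrite kE eqxx in kj.
by rewrite subrr mulr0.
Qed.

(** One element from each link of the chain, each transcendental over the next ones because it
vanishes modulo the larger prime only. The class [G] allows to choose these elements up to units,
for instance with trivial denominators. *)
Lemma independent_mod_chain (R : comNzRingType) (phi : F -> R) (G : R -> Prop) n
    (P : 'I_n.+1 -> prime_idealr R) l :
  (forall x, exists u v, u * v = 1 /\ G (x * u)) ->
  prime_chain P -> independent_mod phi (P ord_max) l ->
  exists xs : seq R, [/\ size xs = n, forall x, x \in xs -> G x &
    independent_mod phi (P ord0) (xs ++ l)].
Proof.
move=> unitG Pch ind.
suff H k : (k <= n)%N -> exists xs : seq R, [/\ size xs = k, forall x, x \in xs -> G x &
    independent_mod phi (P (inord (n - k))) (xs ++ l)].
  have [xs [sxs xsG xsl]] := H n (leqnn _); exists xs; split=> //.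
  rewrite subnn in xsl; suff <- : inord 0 = ord0 :> 'I_n.+1 by [].
  by apply: val_inj; rewrite /= inordK.
elim: k => [|k IH] kn.
  exists [::]; split=> //; rewrite subn0.
  suff -> : inord n = ord_max :> 'I_n.+1 by [].
  by apply: val_inj; rewrite /= inordK.
have [xs [sxs xsG xsl]] := IH (ltnW kn).
have lt_nk : (@inord n (n - k.+1) < @inord n (n - k))%N.
  by rewrite !inordK ?ltnS ?leq_subr // ltn_sub2l.
have [sub nsub] := Pch _ _ lt_nk.
have [x [xP xP']] : exists x, x \in P (inord (n - k)) /\ x \notin P (inord (n - k.+1)).
  apply: contrapT => no; apply: nsub => x xP; apply: contrapT => /negP xP'.
  by apply: no; exists x.
have [u [v [uv Gxu]]] := unitG x.
exists (x * u :: xs); split; first by rewrite /= sxs.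
  by move=> y; rewrite inE => /orP[/eqP ->|/xsG].
apply: independent_mod_cons xsl => //; first by rewrite mulrC idealMr.
apply: contra xP' => xuP; have -> : x = v * (x * u) by rewrite mulrCA [v * u]mulrC uv mulr1.
exact: idealMr.
Qed.

End Independence.


Lemma fractionP (A : idomainType) (x : {fraction A}) :
  exists a b : A, b != 0 /\ x = tofrac a / tofrac b.
Proof.
elim/quotW: x => x; exists (frac x).1, (frac x).2.
have d0 : tofrac (frac x).2 != 0 :> {fraction A} by rewrite tofrac_eq0 denom_ratioP.
split; first exact: denom_ratioP.
apply: (canRL (mulfK d0)); unlock FracField.tofrac; rewrite -[LHS]FracField.pi_mul.
apply/eqmodP; rewrite /= FracField.equivfE /FracField.mulf.
by rewrite !numden_Ratio ?oner_eq0 ?mulf_neq0 ?denom_ratioP ?oner_neq0 // !mulr1 mulrC.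
Qed.

Lemma common_denominator (A : idomainType) (l : seq {fraction A}) :
  exists b : A, b != 0 /\ forall x, x \in l -> exists a, x = tofrac a / tofrac b.
Proof.
elim: l => [|x l [b [b0 bl]]]; first by exists 1; rewrite oner_neq0.
have [a [d [d0 ->]]] := fractionP x; exists (d * b); split; first by rewrite mulf_neq0.
move=> y; rewrite inE => /orP[/eqP ->|/bl[c ->]].
  by exists (a * b); rewrite !rmorphM -mulf_div divff ?mulr1 // tofrac_eq0.
by exists (d * c); rewrite !rmorphM -mulf_div divff ?mul1r // tofrac_eq0.
Qed.

Lemma mulf_div_pad (L : fieldType) (a p u v w : L) :
  v != 0 -> a / w * (p / u) = a * v * p / (w * v * u).
Proof.
move=> v0; rewrite mulf_div [a * v * p]mulrAC [w * v * u]mulrAC -[RHS]mulf_div.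
by rewrite divff // mulr1.
Qed.

Section TranscendenceDegree.

Variables (F : finFieldType) (r : nat).

Local Notation S := {mpoly F[r]}.
Local Notation K := {fraction {mpoly F[r]}}.
Implicit Types (p q : S).

Lemma msizeM_leS i j p q :
  (msize p <= i.+1 -> msize q <= j.+1 -> msize (p * q) <= (i + j).+1)%N.
Proof.
have [->|p0] := eqVneq p 0; first by rewrite mul0r msize0.
have [->|q0] := eqVneq q 0; first by rewrite mulr0 msize0.
move=> pi qj; rewrite msizeM //; move: (msize p) (msize q) pi qj => u v; lia.
Qed.

Lemma msizeX_leS D k p : (msize p <= D.+1)%N -> (msize (p ^+ k)%R <= (D * k).+1)%N.
Proof.
move=> pD; elim: k => [|k IH]; first by rewrite expr0 msize1.
by rewrite exprS mulnS; apply: msizeM_leS.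
Qed.

Definition bounded_coefs M p : {ffun {ffun 'I_r -> 'I_M.+1} -> F} :=
  [ffun e : {ffun 'I_r -> 'I_M.+1} => p@_[multinom nat_of_ord (e i) | i < r]].

Lemma bounded_coefs_inj M p q :
  (msize p <= M.+1)%N -> (msize q <= M.+1)%N ->
  bounded_coefs M p = bounded_coefs M q -> p = q.
Proof.
move=> pM qM pq; apply/mpolyP => m.
have [mM|mM] := leqP (mdeg m) M; last first.
  by rewrite !memN_msupp_eq0 //; apply: msize_mdeg_ge; apply: leq_trans mM.
move/ffunP: pq => /(_ [ffun i => inord (m i)]); rewrite !ffunE.
suff -> : [multinom nat_of_ord ([ffun i => inord (m i)] i : 'I_M.+1) | i < r] = m by [].
apply/mnmP => i; rewrite mnmE ffunE inordK // ltnS; apply: leq_trans mM.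
by rewrite mdegE (bigD1 i) //= leq_addr.
Qed.

Local Notation scal := (fun c : F => tofrac (c%:A : S) : K).

Lemma box_eval_fraction D (b : S) m n (l : seq K) (c : poly_box F m n) :
    b != 0 -> (msize b <= D.+1)%N ->
    (forall x, x \in l -> exists a, (msize a <= D.+1)%N /\ x = tofrac a / tofrac b) ->
  exists p, (msize p <= (D * (m * n)).+1)%N /\
            box_eval scal l c = tofrac p / tofrac b ^+ (m * n).
Proof.
move=> b0 bD; have tb0 : tofrac b != 0 :> K by rewrite tofrac_eq0.
elim: n l c => [|n IH] l c lD.
  exists c%:A; rewrite muln0 muln0 expr0 divr1; split=> //.
  by rewrite (leq_trans (msizeZ_le _ _)) // msize1.
have [a [aD hE]] : exists a, (msize a <= D.+1)%N /\ head 0 l = tofrac a / tofrac b.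
  case: l lD => [_|x l lD]; last by apply: lD; rewrite mem_head.
  by exists 0; rewrite msize0 rmorph0 mul0r.
have /choice[P PP] j : exists p, (msize p <= (D * (m * n)).+1)%N /\
    box_eval scal (behead l) ((c : {ffun _ -> _}) j) = tofrac p / tofrac b ^+ (m * n).
  by apply: IH => x /mem_behead; apply: lD.
exists (\sum_(j < m) a ^+ j * b ^+ (m - j) * P j); split.
  apply: (big_ind (fun p : S => (msize p <= (D * (m * n.+1)).+1)%N)) => [|u v uD vD|j _].
  - by rewrite msize0.
  - by rewrite (leq_trans (msizeD_le _ _)) // geq_max uD.
  - rewrite mulnS mulnDr; apply: msizeM_leS; last by case: (PP j).
    have -> : (D * m = D * j + D * (m - j))%N by rewrite -mulnDr subnKC // ltnW.
    by apply: msizeM_leS; apply: msizeX_leS.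
rewrite /= rmorph_sum mulr_suml; apply: eq_bigr => j _; case: (PP j) => _ ->.
have bj : tofrac b ^+ m = tofrac b ^+ j * tofrac b ^+ (m - j) :> K.
  by rewrite -exprD subnKC // ltnW.
rewrite hE !rmorphM !rmorphXn expr_div_n mulnS exprD bj.
by apply: mulf_div_pad; rewrite expf_neq0.
Qed.

(** Counting: [n] independent elements give [q ^ (m ^ n)] values with exponents below [m], all
of them fractions over a fixed denominator with numerators of degree O(m), of which there are
at most [q ^ (O(m) ^ r)]. *)
Lemma independent_size (l : seq K) :
  independent_mod scal [pred x | x == 0] l -> (size l <= r)%N.
Proof.
move=> ind; have [b [b0 lb]] := common_denominator l.
have [D [bD lD]] : exists D, (msize b <= D.+1)%N /\ forall x, x \in l ->
    exists a, (msize a <= D.+1)%N /\ x = tofrac a / tofrac b.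
  elim: l lb {ind} => [|x l IH] lb; first by exists (msize b).
  have [|D [bD lD]] := IH; first by move=> y yl; apply: lb; rewrite inE yl orbT.
  have [a xE] := lb x (mem_head _ _); exists (maxn D (msize a)); split.
    by apply: leq_trans bD _; rewrite ltnS leq_maxl.
  move=> y; rewrite inE => /orP[/eqP ->|/lD[c [cD ->]]].
    by exists a; split=> //; apply: leqW; rewrite leq_maxr.
  by exists c; split=> //; apply: leq_trans cD _; rewrite ltnS leq_maxl.
set n := size l in ind *; rewrite leqNgt; apply/negP => rn.
have bound m : (m ^ n <= (D * (m * n)).+1 ^ r)%N.
  have /choice[P PP] := fun c => @box_eval_fraction D b m n l c b0 bD lD.
  pose g c := bounded_coefs (D * (m * n)) (P c).
  have ginj : injective g.
    move=> c d /(bounded_coefs_inj (PP c).1 (PP d).1) Pcd; apply/eqP.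
    apply: contraT => /ind; rewrite inE.
    by rewrite (PP c).2 (PP d).2 Pcd subrr eqxx.
  have := leq_card g ginj; rewrite card_poly_box !card_ffun !card_ord.
  by rewrite leq_exp2l // card_finNzRing_gt1.
pose C := (D * n).+1.
have := bound (C ^ r).+1; apply/negP; rewrite -ltnNge.
set m := (C ^ r).+1.
have m_gt0 : (0 < m)%N by [].
apply: (@leq_ltn_trans ((C * m) ^ r)).
  have [->|r0] := posnP r; first by rewrite !expn0.
  by rewrite leq_exp2r // /C mulSn mulnA [(D * m * n)%N]mulnAC -add1n leq_add.
rewrite expnMn; apply: (@leq_trans (m ^ r.+1)); last exact: leq_pexp2l.
by rewrite expnS ltn_pmul2r // expn_gt0.
Qed.

End TranscendenceDegree.

(** * Freeness of partial fractions *)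

Definition transcendental_over (K : fieldType) (E : {pred K}) (t : K) :=
  forall p : {poly K}, p \is a polyOver E -> p.[t] = 0 -> p = 0.

Section PolarParts.

Variables (K : fieldType) (E : divringClosed K) (W : seq K) (t : K).
Hypotheses (Wuniq : uniq W) (W0 : 0 \in W) (WE : {subset W <= E}).
Hypothesis tE : transcendental_over E t.

Definition polar (w : K) : K := (t + w)^-1.
(** The logarithmic derivative of the product of all [t + w]; it has a simple pole at every
[t = - w]. *)
Definition polar_sum : K := \sum_(w <- W) polar w.
Definition polar_basis (w : K) : K := if w == 0 then 1 else polar w.
Definition polar_comb (p : K -> {poly K}) : K :=
  \sum_(w <- W) (p w).[polar_sum] * polar_basis w.

Lemma transcendental_addr_neq0 w : w \in E -> t + w != 0.
Proof.
move=> wE; apply/eqP => tw0.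
have := tE (p := 'X + w%:P); rewrite polyOverXaddC => /(_ wE).
rewrite !hornerE => /(_ tw0) /eqP.
by rewrite -[w]opprK polyCN polyXsubC_eq0.
Qed.

Lemma transcendental_poly_eq (p q : {poly K}) :
  p \is a polyOver E -> q \is a polyOver E -> p.[t] = q.[t] -> p = q.
Proof.
move=> pE qE pq; apply/eqP; rewrite -subr_eq0; apply/eqP/tE; first exact: rpredB.
by rewrite !hornerE pq subrr.
Qed.

Section Span.

Variables B C : subringClosed K.
Hypothesis WB : {in W &, forall u w, u != w -> (u - w)^-1 \in B}.
Hypothesis C_ind : forall X : K -> Prop,
  (forall b, b \in B -> X b) -> (forall w, w \in W -> X (polar w)) ->
  (forall x y, X x -> X y -> X (x + y)) -> (forall x y, X x -> X y -> X (x * y)) ->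
  forall z, z \in C -> X z.

Lemma polarM u w : u \in W -> w \in W -> u != w ->
  polar u * polar w = (w - u)^-1 * (polar u - polar w).
Proof.
move=> uW wW uw; rewrite /polar.
have tu := transcendental_addr_neq0 (WE uW); have tw := transcendental_addr_neq0 (WE wW).
have wu : w - u != 0 by rewrite subr_eq0 eq_sym.
by field; rewrite wu tu tw.
Qed.

Let M z := exists p, (forall w, p w \is a polyOver B) /\ z = polar_comb p.

Let M_add x y : M x -> M y -> M (x + y).
Proof.
move=> [p [pB ->]] [q [qB ->]]; exists (fun w => p w + q w); split=> [w|].
  exact: rpredD.
by rewrite /polar_comb -big_split; apply: eq_bigr => w _; rewrite hornerD mulrDl.
Qed.

Let M_mulp (p : {poly K}) x : p \is a polyOver B -> M x -> M (p.[polar_sum] * x).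
Proof.
move=> pB [q [qB ->]]; exists (fun w => p * q w); split=> [w|]; first exact: rpredM.
by rewrite /polar_comb mulr_sumr; apply: eq_bigr => w _; rewrite hornerM mulrA.
Qed.

Let M_scale b x : b \in B -> M x -> M (b * x).
Proof. by move=> bB Mx; rewrite -[b](hornerC b polar_sum); apply: M_mulp; rewrite ?polyOverC. Qed.

Let M_opp x : M x -> M (- x).
Proof. by move=> Mx; rewrite -mulN1r; apply: M_scale => //; rewrite rpredN rpred1. Qed.

Let M_sub x y : M x -> M y -> M (x - y).
Proof. by move=> Mx My; apply: M_add => //; apply: M_opp. Qed.

Let M_basis w : w \in W -> M (polar_basis w).
Proof.
move=> wW; exists (fun u => (u == w)%:R%:P); split=> [u|].
  by rewrite polyOverC rpred_nat.
rewrite /polar_comb (bigD1_seq w) //= eqxx hornerC mul1r big1 ?addr0 // => u /negPf ->.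
by rewrite hornerC mul0r.
Qed.

Let M_1 : M 1. Proof. by have := M_basis W0; rewrite /polar_basis eqxx. Qed.

Let M_0 : M 0. Proof. by have := M_sub M_1 M_1; rewrite subrr. Qed.

Let M_sum (P : pred K) (f : K -> K) :
  (forall w, w \in W -> P w -> M (f w)) -> M (\sum_(w <- W | P w) f w).
Proof.
by move=> fM; rewrite big_seq_cond; apply: big_ind => // w /andP[]; apply: fM.
Qed.

Let M_polar w : w \in W -> M (polar w).
Proof.
have Mnz u : u \in W -> u != 0 -> M (polar u).
  by move=> uW /negPf u0; have := M_basis uW; rewrite /polar_basis u0.
have [->|w0 wW] := eqVneq w 0; last exact: Mnz.
move=> _; have -> : polar 0 = polar_sum - \sum_(u <- W | u != 0) polar u.
  by rewrite /polar_sum (bigD1_seq 0) //= addrK.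
apply: M_sub; last by apply: M_sum => u uW u0; apply: Mnz.
by rewrite -[polar_sum]mulr1 -{1}[polar_sum]hornerX; apply: M_mulp => //; exact: polyOverX.
Qed.

Let M_polar2 u w : u \in W -> w \in W -> M (polar u * polar w).
Proof.
move=> uW wW; have Mne x y : x \in W -> y \in W -> x != y -> M (polar x * polar y).
  move=> xW yW xy; rewrite polarM //; apply: M_scale; first by apply: WB; rewrite // eq_sym.
  by apply: M_sub; apply: M_polar.
have [<-|uw] := eqVneq u w; last exact: Mne.
have -> : polar u * polar u = polar_sum * polar u - \sum_(x <- W | x != u) polar x * polar u.
  by rewrite /polar_sum mulr_suml (bigD1_seq u) //= addrK.
apply: M_sub; last by apply: M_sum => x xW xu; apply: Mne.
by rewrite -[polar_sum]hornerX; apply: M_mulp; [exact: polyOverX|exact: M_polar].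
Qed.

(** The combinations are closed under products because the product of two distinct polar parts
is a combination of both, which in turn expresses squares through the sum of all of them. *)
Lemma polar_comb_span z : z \in C ->
  exists p, (forall w, p w \is a polyOver B) /\ z = polar_comb p.
Proof.
move: z; apply: C_ind => //.
- by move=> b bB; rewrite -[b]mulr1; apply: M_scale.
- move=> _ y [p [pB ->]] My; rewrite /polar_comb mulr_suml; apply: M_sum => u uW _.
  rewrite -mulrA; apply: M_mulp => //; case: My => [q [qB ->]].
  rewrite /polar_comb mulr_sumr; apply: M_sum => w wW _.
  rewrite mulrCA; apply: M_mulp => //; rewrite /polar_basis.
  case: eqP => _; case: eqP => _; rewrite ?mul1r ?mulr1; try exact: M_polar.
    exact: M_1.
  exact: M_polar2.
Qed.

End Span.

Let f : {poly K} := \prod_(w <- W) ('X + w%:P).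
Let g (u : K) : {poly K} := \prod_(w <- W | w != u) ('X + w%:P).
Let G : {poly K} := \sum_(w <- W) g w.

Lemma polar_prod_over : f \is a polyOver E.
Proof. by rewrite /f big_seq; apply: rpred_prod => w /WE; rewrite polyOverXaddC. Qed.

Let f_over := polar_prod_over.

Let g_over u : g u \is a polyOver E.
Proof.
by rewrite /g big_seq_cond; apply: rpred_prod => w /andP[/WE]; rewrite polyOverXaddC.
Qed.

Let G_over : G \is a polyOver E. Proof. by apply: rpred_sum => w _; exact: g_over. Qed.

Lemma polar_prod_neq0 : f.[t] != 0.
Proof.
rewrite /f horner_prod prodf_seq_neq0; apply/allP => w /WE wE /=.
by rewrite !hornerE transcendental_addr_neq0.
Qed.

Let fg u : u \in W -> f = ('X + u%:P) * g u.
Proof. by move=> uW; rewrite /f (bigD1_seq u). Qed.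

Let f_root u : u \in W -> f.[- u] = 0.
Proof. by move=> uW; rewrite (fg uW) !hornerE addNr mul0r. Qed.

Let g_root u w : u \in W -> u != w -> (g w).[- u] = 0.
Proof.
move=> uW uw; rewrite /g -big_filter (bigD1_seq u) ?filter_uniq ?mem_filter ?uw //=.
by rewrite !hornerE addNr mul0r.
Qed.

Let g_self u : u \in W -> (g u).[- u] != 0.
Proof.
move=> uW; rewrite /g horner_prod prodf_seq_neq0; apply/allP => w wW /=.
by apply/implyP => wu; rewrite !hornerE addrC subr_eq0.
Qed.

Let polar_g u : u \in W -> f.[t] * polar u = (g u).[t].
Proof.
move=> uW; rewrite (fg uW) /polar !hornerE mulrAC divff ?mul1r //.
by rewrite transcendental_addr_neq0 ?WE.
Qed.

Let polar_sum_G : f.[t] * polar_sum = G.[t].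
Proof.
by rewrite /polar_sum mulr_sumr horner_sum big_seq [RHS]big_seq; apply: eq_bigr => w /polar_g.
Qed.

Let G_neq0 u : u \in W -> G.[- u] != 0.
Proof.
move=> uW; rewrite /G horner_sum (bigD1_seq u) //= big1 ?addr0 ?g_self // => w wu.
by rewrite g_root // eq_sym.
Qed.

(* the numerator of [p.[polar_sum]] over the denominator [f ^+ D] *)
Let H (D : nat) (p : {poly K}) : {poly K} := \sum_(k < D.+1) p`_k *: (G ^+ k * f ^+ (D - k)).

Let H_over D p : p \is a polyOver E -> H D p \is a polyOver E.
Proof.
move=> pE; apply: rpred_sum => k _; rewrite polyOverZ //; first exact: (polyOverP pE).
by rewrite rpredM ?rpredX.
Qed.

Let H_eval D (p : {poly K}) : (size p <= D.+1)%N -> (H D p).[t] = f.[t] ^+ D * p.[polar_sum].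
Proof.
move=> sp; rewrite (horner_coef_wide _ sp) mulr_sumr horner_sum; apply: eq_bigr => k _.
rewrite hornerZ hornerM !horner_exp -polar_sum_G exprMn [RHS]mulrCA; congr (_ * _).
by rewrite mulrAC -exprD subnKC // -ltnS.
Qed.

Let H_lead D (p : {poly K}) u : u \in W -> (H D p).[- u] = p`_D * G.[- u] ^+ D.
Proof.
move=> uW; rewrite horner_sum big_ord_recr /= subnn expr0 mulr1 hornerZ horner_exp big1 ?add0r //.
move=> k _; rewrite hornerZ hornerM !horner_exp f_root // expr0n subn_eq0 leqNgt ltn_ord.
by rewrite !mulr0.
Qed.

Let coef_lead_eq0 D (p : {poly K}) : p`_D = 0 -> (size p <= D.+1)%N -> (size p <= D)%N.
Proof.
move=> pD sp; apply/leq_sizeP => j; rewrite leq_eqVlt => /orP[/eqP <- //|Dj].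
by rewrite nth_default // (leq_trans sp).
Qed.

(** Compare the highest poles: a term of degree [D] times [polar u] contributes a pole of order
[D + 1] at [- u], which nothing else reaches; once these are excluded, a term of degree [D] times
the basis element 1 is alone in having a pole of order [D] at 0. *)
Lemma polar_comb_free (p : K -> {poly K}) :
    (forall w, w \in W -> p w \is a polyOver E) -> polar_comb p = 0 ->
  forall w, w \in W -> p w = 0.
Proof.
move=> pE p0; have [D pD] : exists D, forall w, w \in W -> (size (p w) <= D)%N.
  exists (\max_(w <- W) size (p w)) => w wW; exact: leq_bigmax_seq.
elim: D pD => [|D IH] pD w wW.
  by apply/eqP; rewrite -size_poly_eq0 -leqn0 pD.
move: p0; rewrite /polar_comb (bigD1_seq 0) //= [polar_basis 0]/polar_basis eqxx mulr1 => p0.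
have comb0 : (p 0).[polar_sum] + \sum_(u <- W | u != 0) (p u).[polar_sum] * polar u = 0.
  rewrite -[RHS]p0; congr (_ + _); apply: eq_bigr => u /negPf u0.
  by rewrite /polar_basis u0.
have id1 : H D (p 0) * f + \sum_(u <- W | u != 0) H D (p u) * g u = 0.
  apply: tE.
    rewrite rpredD ?rpredM ?H_over ?pE // big_seq_cond rpred_sum // => u /andP[uW _].
    by rewrite rpredM ?H_over ?pE.
  rewrite hornerD hornerM H_eval ?pD // horner_sum.
  transitivity (f.[t] ^+ D * f.[t] * 0); last by rewrite mulr0.
  rewrite -[in RHS]comb0 mulrDr mulrAC; congr (_ + _).
  rewrite mulr_sumr big_seq_cond [RHS]big_seq_cond; apply: eq_bigr => u /andP[uW _].
  by rewrite hornerM H_eval ?pD // -polar_g // mulrACA.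
have lead_nz u : u \in W -> u != 0 -> (size (p u) <= D)%N.
  move=> uW u0; apply: coef_lead_eq0; last exact: pD.
  move/(congr1 (horner^~ (- u))): id1; rewrite /= hornerD hornerM f_root // mulr0 add0r.
  rewrite horner_sum -big_filter (bigD1_seq u) ?filter_uniq ?mem_filter ?u0 //=.
  rewrite big1 ?addr0 => [|x xu]; last by rewrite hornerM g_root ?mulr0 // eq_sym.
  rewrite hornerM H_lead // horner0 => /eqP; rewrite !mulf_eq0 (negPf (g_self uW)) orbF.
  by rewrite (negPf (expf_neq0 _ (G_neq0 uW))) orbF => /eqP.
suff lead_0 : (size (p 0%R) <= D)%N.
  by apply: IH => // u uW; have [->//|u0] := eqVneq u 0; apply: lead_nz.
apply: coef_lead_eq0; last exact: pD.
have id2 : H D (p 0) + \sum_(u <- W | u != 0) H D.-1 (p u) * g u = 0.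
  apply: tE.
    rewrite rpredD ?H_over ?pE // big_seq_cond rpred_sum // => u /andP[uW _].
    by rewrite rpredM ?H_over ?pE.
  rewrite hornerD H_eval ?pD // horner_sum.
  transitivity (f.[t] ^+ D * 0); last by rewrite mulr0.
  rewrite -[in RHS]comb0 mulrDr; congr (_ + _).
  rewrite mulr_sumr big_seq_cond [RHS]big_seq_cond; apply: eq_bigr => u /andP[uW u0].
  have := lead_nz u uW u0; rewrite hornerM; case: (D) => [|D'] sD.
    have -> : p u = 0 by apply/eqP; rewrite -size_poly_eq0 -leqn0.
    by rewrite H_eval ?size_poly0 // !horner0 mulr0 !mul0r mulr0.
  by rewrite H_eval // -polar_g // mulrACA -exprSr.
move/(congr1 (horner^~ (- 0))): id2; rewrite hornerD H_lead //.
rewrite [X in _ + X]horner_sum big1 => [|u u0].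
  rewrite addr0 horner0 => /eqP; rewrite mulf_eq0.
  by rewrite (negPf (expf_neq0 _ (G_neq0 W0))) orbF => /eqP.
by rewrite hornerM g_root ?mulr0 // eq_sym.
Qed.

End PolarParts.

(** * Regular sequences along a free extension *)

Section SpanIn.

Variable K : fieldType.
Implicit Types (s : seq K) (x y : K).

Definition span_in (B : {pred K}) s x :=
  exists c : nat -> K, (forall i, c i \in B) /\ x = \sum_(i < size s) c i * s`_i.

Lemma span_in_mem (B : subringClosed K) s x : x \in s -> span_in B s x.
Proof.
move=> xs; have sz : (index x s < size s)%N by rewrite index_mem.
exists (fun i => (i == index x s)%:R); split=> [i|]; first exact: rpred_nat.
rewrite (bigD1 (Ordinal sz)) //= eqxx mul1r nth_index // big1 ?addr0 // => i ix.
suff /negPf -> : nat_of_ord i != index x s by rewrite mul0r.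
by apply: contra ix => /eqP ix; apply/eqP/val_inj.
Qed.

Lemma span_in0 (B : subringClosed K) s : span_in B s 0.
Proof.
by exists (fun=> 0); split=> [_|]; rewrite ?rpred0 // big1 // => i _; rewrite mul0r.
Qed.

Lemma span_inD (B : subringClosed K) s x y : span_in B s x -> span_in B s y -> span_in B s (x + y).
Proof.
move=> [c [cB ->]] [d [dB ->]]; exists (fun i => c i + d i); split=> [i|].
  exact: rpredD.
by rewrite -big_split; apply: eq_bigr => i _; rewrite mulrDl.
Qed.

Lemma span_inM (B : subringClosed K) s b x : b \in B -> span_in B s x -> span_in B s (b * x).
Proof.
move=> bB [c [cB ->]]; exists (fun i => b * c i); split=> [i|]; first exact: rpredM.
by rewrite mulr_sumr; apply: eq_bigr => i _; rewrite mulrA.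
Qed.

Lemma span_in_sum (B : subringClosed K) s (I : Type) (r : seq I) (P : pred I) (f : I -> K) :
  (forall i, P i -> span_in B s (f i)) -> span_in B s (\sum_(i <- r | P i) f i).
Proof. by move=> fs; apply: big_ind => //; [exact: span_in0|exact: span_inD]. Qed.

Lemma span_in_sub (B C : {pred K}) s x : {subset B <= C} -> span_in B s x -> span_in C s x.
Proof. by move=> BC [c [cB ->]]; exists c; split=> // i; apply: BC. Qed.

Record prime_in (B Q : {pred K}) : Prop := PrimeIn {
  prime_in0 : 0 \in Q;
  prime_in1 : 1 \notin Q;
  prime_inD : {in Q &, forall x y, x + y \in Q};
  prime_inMl : {in B & Q, forall b x, b * x \in Q};
  prime_inM : {in B &, forall x y, x * y \in Q -> (x \in Q) || (y \in Q)} }.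

Lemma prime_in_sub (B C Q : {pred K}) : {subset B <= C} -> prime_in C Q -> prime_in B Q.
Proof.
move=> BC [Q0 Q1 QD QMl QM]; split=> //; first by move=> b x /BC; apply: QMl.
by move=> x y /BC xC /BC; apply: QM.
Qed.

Lemma prime_inX (B : subringClosed K) (Q : {pred K}) b n :
  prime_in B Q -> b \in B -> b \notin Q -> b ^+ n \notin Q.
Proof.
move=> pQ bB bQ; elim: n => [|n IH]; first by rewrite expr0 (prime_in1 pQ).
rewrite exprS; apply/negP => /(prime_inM pQ bB (rpredX n bB)).
by rewrite (negPf bQ) (negPf IH).
Qed.

(** Regularity in the localization at [Q], with denominators cleared. *)
Definition regular_off (B Q : {pred K}) s := forall k x, (k < size s)%N -> x \in B ->
  span_in B (take k s) (s`_k * x) ->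
  exists t, [/\ t \in B, t \notin Q & span_in B (take k s) (t * x)].

End SpanIn.

Section FreeExtension.

Variables (F : finFieldType) (K : fieldType) (phi : F -> K).
Variables (B C : subringClosed K) (I : eqType) (W : seq I) (e : I -> K) (theta : K).
Hypothesis phiB : forall c, phi c \in B.
Hypotheses (BC : {subset B <= C}) (thetaC : theta \in C) (eC : forall w, w \in W -> e w \in C).

Let comb (p : I -> {poly K}) := \sum_(w <- W) (p w).[theta] * e w.

Hypothesis comb_span : forall z, z \in C ->
  exists p, (forall w, p w \is a polyOver B) /\ z = comb p.
Hypothesis comb_free : forall p, (forall w, p w \is a polyOver B) -> comb p = 0 ->
  forall w, w \in W -> p w = 0.

Variable Q : {pred K}.
Hypothesis primeQ : prime_in C Q.

Let primeQB : prime_in B Q := prime_in_sub BC primeQ.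

(** Membership in an ideal extended from [B] can be tested on coordinates. *)
Lemma span_in_coords s f p : {subset s <= B} -> f \is a polyOver B ->
    (forall w, p w \is a polyOver B) -> span_in C s (f.[theta] * comb p) ->
  forall w m, w \in W -> span_in B s (f * p w)`_m.
Proof.
move=> sB fB pB [c [cC cE]].
have /choice[q qP] i : exists q, (forall w, q w \is a polyOver B) /\ c i = comb q.
  by apply: comb_span; apply: cC.
have sumB w : \sum_(i < size s) s`_i *: q i w \is a polyOver B.
  apply: rpred_sum => i _; apply: polyOverZ; last by case: (qP i).
  exact/sB/mem_nth.
have d0 : comb (fun w => f * p w - \sum_(i < size s) s`_i *: q i w) = 0.
  have sumE : \sum_(i < size s) c i * s`_i =
      \sum_(w <- W) \sum_(i < size s) (q i w).[theta] * e w * s`_i.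
    by rewrite exchange_big; apply: eq_bigr => i _; rewrite (qP i).2 /comb mulr_suml.
  transitivity (f.[theta] * comb p - \sum_(i < size s) c i * s`_i); last by rewrite cE subrr.
  rewrite sumE /comb mulr_sumr -sumrB; apply: eq_bigr => w _.
  rewrite hornerD hornerN hornerM mulrBl mulrA horner_sum mulr_suml; congr (_ - _).
  by apply: eq_bigr => i _; rewrite hornerZ mulrAC mulrC mulrA mulrAC.
move=> w m wW.
have /eqP := comb_free (fun w => rpredB (rpredM fB (pB w)) (sumB w)) d0 wW.
rewrite subr_eq0 => /eqP ->; exists (fun i => (q i w)`_m); split=> [i|].
  by apply/polyOverP; case: (qP i).
by rewrite coef_sum; apply: eq_bigr => i _; rewrite coefZ mulrC.
Qed.

Lemma common_multiplier s (l : seq K) :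
    (forall x, x \in l -> exists t, [/\ t \in B, t \notin Q & span_in B s (t * x)]) ->
  exists t, [/\ t \in B, t \notin Q & forall x, x \in l -> span_in B s (t * x)].
Proof.
elim: l => [|x l IH] lP; first by exists 1; rewrite rpred1 (prime_in1 primeQ).
have [t [tB tQ tx]] := lP x (mem_head _ _).
have [|u [uB uQ ul]] := IH; first by move=> y yl; apply: lP; rewrite inE yl orbT.
exists (t * u); split; first exact: rpredM.
  by apply/negP => /(prime_inM primeQB tB uB); rewrite (negPf tQ) (negPf uQ).
move=> y; rewrite inE => /orP[/eqP ->|/ul uy]; last by rewrite -mulrA; apply: span_inM.
by rewrite mulrAC mulrC; apply: span_inM.
Qed.

Lemma span_in_of_coords s p : (forall w, p w \is a polyOver B) ->
    (forall w m, w \in W -> exists t, [/\ t \in B, t \notin Q & span_in B s (t * (p w)`_m)]) ->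
  exists t, [/\ t \in C, t \notin Q & span_in C s (t * comb p)].
Proof.
move=> pB pt; have [|t [tB tQ tp]] := @common_multiplier s (flatten [seq p w : seq K | w <- W]).
  move=> _ /flattenP[_ /mapP[w wW ->]] /(nthP 0)[m _ <-]; exact: pt.
exists t; split=> //; first exact: BC.
rewrite /comb mulr_sumr big_seq; apply: span_in_sum => w wW.
rewrite mulrA mulrC; apply: span_inM; first exact: eC.
rewrite horner_coef mulr_sumr; apply: span_in_sum => m _.
rewrite mulrA mulrC; apply: span_inM; first exact: rpredX.
apply: (span_in_sub BC); apply: tp; apply/flattenP; exists (p w : seq K).
  exact: map_f.
exact: mem_nth.
Qed.

Lemma regular_off_extend s : {subset s <= B} -> regular_off B Q s -> regular_off C Q s.
Proof.
move=> sB reg k x ks xC sx; have [p [pB xE]] := comb_span xC.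
have sk : s`_k \in B by apply/sB/mem_nth.
rewrite xE in sx *; apply: span_in_of_coords => // w m wW.
apply: (reg k) => //; first exact: (polyOverP (pB w)).
rewrite -coefCM; apply: span_in_coords wW => //.
- by move=> y /mem_take /sB.
- by rewrite polyOverC.
- by rewrite hornerC.
Qed.

(** Modulo [Q] the leading coefficient of [f] is invertible, so a product with [f] has
coefficients in the span of [s] only if the other factor does, up to a power of it. *)
Lemma span_in_lead_coef s (f p : {poly K}) n : f \is a polyOver B -> p \is a polyOver B ->
    (size p <= n)%N -> (forall m, span_in B s (f * p)`_m) ->
  forall m, span_in B s (lead_coef f ^+ n * p`_m).
Proof.
move=> fB; set a := lead_coef f; have aB : a \in B by apply: (polyOverP fB).
elim: n p => [|n IH] p pB sp fp m.
  by move: sp; rewrite leqn0 size_poly_eq0 => /eqP ->; rewrite coef0 mulr0; apply: span_in0.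
have pn : p`_n \in B by apply: (polyOverP pB).
have [f0|f0] := eqVneq f 0.
  by rewrite /a f0 lead_coef0 expr0n mul0r; apply: span_in0.
have top : span_in B s (a * p`_n).
  suff <- : (f * p)`_(n + (size f).-1) = a * p`_n by [].
  set q := p - p`_n *: 'X^n; have pE : p = q + p`_n *: 'X^n by rewrite subrK.
  have sq : (size q <= n)%N.
    apply/leq_sizeP => j; rewrite leq_eqVlt coefB coefZ coefXn.
    move=> /orP[/eqP <-|nj]; first by rewrite eqxx mulr1 subrr.
    by rewrite gtn_eqF // mulr0 subr0 nth_default // (leq_trans sp).
  rewrite [in LHS]pE mulrDr coefD -scalerAr coefZ coefMXn ltnNge leq_addr /= addKn.
  rewrite nth_default ?add0r; first by rewrite mulrC.
  apply: leq_trans (size_polyMleq _ _) _.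
  by move: f0; rewrite -size_poly_gt0; move: (size f) (size q) sq => u v; lia.
have := IH (a *: p - (a * p`_n) *: 'X^n); rewrite rpredB ?polyOverZ ?polyOverXn ?rpredM //.
move=> /(_ isT) IHp.
have {IHp} := IHp _ _ m; rewrite coefB !coefZ coefXn => IHp.
have -> : a ^+ n.+1 * p`_m = a ^+ n * (a * p`_m - a * p`_n * (m == n)%:R)
                             + (a ^+ n * (m == n)%:R) * (a * p`_n) by rewrite exprSr; ring.
apply: span_inD; last by apply: span_inM => //; rewrite rpredM ?rpredX ?rpred_nat.
apply: IHp.
- apply/leq_sizeP => j; rewrite leq_eqVlt coefB !coefZ coefXn.
  move=> /orP[/eqP <-|nj]; first by rewrite eqxx mulr1 subrr.
  by rewrite gtn_eqF // mulr0 subr0 nth_default ?mulr0 // (leq_trans sp).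
- move=> j; rewrite mulrBr -!scalerAr coefB !coefZ coefMXn -mulrN mulrC.
  apply: span_inD; first by rewrite mulrC; apply: span_inM.
  rewrite mulrC; apply: span_inM => //; rewrite rpredN; case: ifP => _; first exact: rpred0.
  exact: (polyOverP fB).
Qed.

Lemma regular_off_rcons s f : {subset s <= B} -> regular_off B Q s ->
    f \is a polyOver B -> lead_coef f \notin Q -> regular_off C Q (rcons s f.[theta]).
Proof.
move=> sB reg fB fQ k x; rewrite size_rcons ltnS leq_eqVlt => /orP[/eqP ->|ks] xC.
  rewrite nth_rcons ltnn eqxx -cats1 take_size_cat // => sx.
  have [p [pB xE]] := comb_span xC; rewrite xE in sx *.
  apply: span_in_of_coords => // w m wW; exists (lead_coef f ^+ size (p w)).
  have fl : lead_coef f \in B by apply: (polyOverP fB).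
  split; [exact: rpredX|exact: (prime_inX _ primeQB fl fQ)|].
  by apply: span_in_lead_coef => // j; apply: span_in_coords wW.
rewrite nth_rcons ks -cats1 takel_cat ?(ltnW ks) // => sx.
exact: (regular_off_extend sB reg).
Qed.

Lemma box_eval_in m n l (c : poly_box F m n) : {subset l <= B} -> box_eval phi l c \in B.
Proof.
elim: n l c => [|n IH] l c lB //=; apply: rpred_sum => j _; rewrite rpredM ?rpredX //.
  by case: l lB => [_|x l lB]; [exact: rpred0|apply: lB; rewrite mem_head].
by apply: IH => x /mem_behead/lB.
Qed.

(** [r] is the number of free extensions made to reach [D]. Each has contributed one term, either
to a regular sequence [s] in [Q] or to a family [y] independent modulo [Q]. *)
Definition prime_parameters (D : {pred K}) (r : nat) := exists s y : seq K,
  [/\ {subset s <= D} /\ {subset s <= Q}, {subset y <= D}, regular_off D Q s,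
      independent_mod phi Q y & (size s + size y = r)%N].

(** If [theta] satisfies an equation modulo [Q] over [B], nontrivial modulo [Q], that equation
extends the regular sequence; otherwise [theta] extends the independent family. *)
Lemma prime_parameters_extend r : prime_parameters B r -> prime_parameters C r.+1.
Proof.
move=> [s [y [[sB sQ] yB reg ind szE]]].
have [[p [pB pQ [i piQ]]]|trans] := pselect (exists p : {poly K},
    [/\ p \is a polyOver B, p.[theta] \in Q & exists i, p`_i \notin Q]).
- have [f [fB fQ lfQ]] : exists f : {poly K},
      [/\ f \is a polyOver B, f.[theta] \in Q & lead_coef f \notin Q].
    have [n] := ubnP (size p); elim: n => // n IH in p pB pQ i piQ *; rewrite ltnS => sp.
    have [lQ|] := boolP (lead_coef p \in Q); last by exists p.
    have p0 : p != 0 by apply: contraNneq piQ => ->; rewrite coef0 (prime_in0 primeQ).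
    have lB : lead_coef p \in B by apply: (polyOverP pB).
    set d := (size p).-1; have dE : d.+1 = size p by rewrite prednK // size_poly_gt0.
    apply: (IH (p - lead_coef p *: 'X^d) _ _ i).
    + by rewrite rpredB ?polyOverZ ?polyOverXn.
    + rewrite !hornerE -mulNr mulrC; apply: (prime_inD primeQ) => //.
      rewrite mulrN -mulNr; apply: (prime_inMl primeQ) => //.
      by rewrite rpredN rpredX.
    + rewrite coefB coefZ coefXn; case: (i =P d) piQ => [-> /negP[]//|_].
      by rewrite mulr0 subr0.
    + apply: leq_trans sp; rewrite -dE; apply/leq_sizeP => j.
      rewrite leq_eqVlt coefB coefZ coefXn => /orP[/eqP <-|dj].
        by rewrite eqxx mulr1 subrr.
      by rewrite gtn_eqF // mulr0 subr0 nth_default // -dE.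
  exists (rcons s f.[theta]), y; split=> //.
  + split=> x; rewrite mem_rcons inE => /orP[/eqP -> | xs] //.
    * by apply: rpred_horner => //; apply: polyOverS fB; exact: BC.
    * exact/BC/sB.
    * exact: sQ.
  + by move=> x /yB/BC.
  + exact: regular_off_rcons.
  + by rewrite size_rcons addSn szE.
- exists s, (theta :: y); split=> //.
  + by split=> // x /sB/BC.
  + by move=> x; rewrite inE => /orP[/eqP ->|/yB/BC].
  + exact: regular_off_extend.
  + move=> m c d cd /=; apply/negP => cdQ.
    have /existsP[j /eqP cdj] : [exists j, c j != d j].
      by rewrite -negb_forall; apply: contra cd => /forallP cd; apply/eqP/ffunP => j; apply/eqP.
    apply: trans; pose h j := box_eval phi y (c j) - box_eval phi y (d j).
    exists (\sum_(j < m) h j *: 'X^j); split.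
    * by apply: rpred_sum => k _; rewrite polyOverZ ?polyOverXn // rpredB ?box_eval_in.
    * rewrite horner_sum; move: cdQ; rewrite -sumrB; congr (_ \in Q); apply: eq_bigr => k _.
      by rewrite !hornerE -mulrBr mulrC.
    * exists (nat_of_ord j); rewrite coef_sum (bigD1 j) //= coefZ coefXn eqxx mulr1 big1.
        by rewrite addr0; apply: ind; apply/eqP.
      move=> k kj; rewrite coefZ coefXn; case: eqP => [jk|]; last by rewrite mulr0.
      by case/eqP: kj; apply: val_inj.
  + by rewrite /= addnS szE.
Qed.

End FreeExtension.

(** * Residues of rational functions *)

Section PolyOver.

Variables (K : fieldType) (E : divringClosed K).
Implicit Types (p q h : {poly K}).

Lemma polyOver_edivp p h : p \is a polyOver E -> h \is a polyOver E -> h != 0 ->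
  exists u v, [/\ u \is a polyOver E, v \is a polyOver E, p = u * h + v & (size v < size h)%N].
Proof.
move=> + hE h0; have [n] := ubnP (size p); elim: n p => // n IH p; rewrite ltnS => sp pE.
have [ph|hp] := ltnP (size p) (size h).
  by exists 0, p; rewrite rpred0 mul0r add0r.
have lh0 : lead_coef h != 0 by rewrite lead_coef_eq0.
set c := (lead_coef p / lead_coef h) *: 'X^(size p - size h).
have cE : c \is a polyOver E.
  by rewrite polyOverZ ?polyOverXn // rpred_div //; [apply: (polyOverP pE)|apply: (polyOverP hE)].
have p0 : p != 0 by rewrite -size_poly_gt0 (leq_trans _ hp) // size_poly_gt0.
have spc : (size (p - c * h)%R < size p)%N.
  have sp1 : ((size p).-1.+1 = size p)%N by rewrite prednK // size_poly_gt0.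
  rewrite -sp1 ltnS; apply/leq_sizeP => j; rewrite leq_eqVlt coefB /c -scalerAl coefZ coefXnM.
  have sh1 : ((size h).-1.+1 = size h)%N by rewrite prednK // size_poly_gt0.
  move=> /orP[/eqP <-|pj].
    rewrite ifN; last by rewrite -leqNgt; lia.
    have -> : ((size p).-1 - (size p - size h) = (size h).-1)%N by lia.
    by rewrite -/(lead_coef h) divfK // subrr.
  rewrite nth_default -1?sp1 // sub0r; case: ifP => _; first by rewrite mulr0 oppr0.
  rewrite nth_default ?mulr0 ?oppr0 //.
  by move: sp1 sh1 pj hp; move: (size p) (size h) => u v; lia.
have [||u [v [uE vE pE' sv]]] := IH (p - c * h).
- exact: leq_trans spc sp.
- by rewrite rpredB ?rpredM.
exists (c + u), v; split=> //; first exact: rpredD.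
by rewrite mulrDl -addrA -pE' addrC subrK.
Qed.

Lemma polyOver_factor p a : p \is a polyOver E -> a \in E -> p.[a] = 0 ->
  exists q, q \is a polyOver E /\ p = q * ('X - a%:P).
Proof.
move=> pE aE pa.
have [|||u [v [uE vE pE' sv]]] := @polyOver_edivp p ('X - a%:P) => //.
- by rewrite polyOverXsubC.
- by rewrite polyXsubC_eq0.
exists u; split=> //; rewrite pE'; suff -> : v = 0 by rewrite addr0.
rewrite size_XsubC ltnS in sv; have vC := size1_polyC sv.
by move: pa; rewrite pE' !hornerE subrr mulr0 add0r vC hornerC => ->.
Qed.

Lemma polyOver_multiplicity p a : p \is a polyOver E -> a \in E -> p != 0 ->
  exists i q, [/\ q \is a polyOver E, q.[a] != 0 & p = q * ('X - a%:P) ^+ i].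
Proof.
move=> + aE; have [n] := ubnP (size p); elim: n p => // n IH p; rewrite ltnS => sp pE p0.
have [pa|pa] := eqVneq p.[a] 0; last by exists 0, p; rewrite mulr1.
have [q [qE pq]] := polyOver_factor pE aE pa.
have q0 : q != 0 by apply: contraNneq p0 => q0; rewrite pq q0 mul0r.
have [|i [r [rE ra qr]]] := IH q _ qE q0.
  by apply: leq_trans sp; rewrite pq size_Mmonic ?monicXsubC // size_XsubC addn2.
by exists i.+1, r; split=> //; rewrite pq qr exprSr mulrA.
Qed.

End PolyOver.

(** If [h ^+ n] divides [d * g ^+ n] for all [n], cancelling the gcd leaves powers of the
remaining factor of [h] dividing [d], so that factor is constant. *)
Lemma dvdp_of_dvdp_exp (K : fieldType) (d g h : {poly K}) :
  d != 0 -> h != 0 -> (forall n, (h ^+ n %| d * g ^+ n)%R) -> (h %| g)%R.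
Proof.
move=> d0 h0 hd; have [e_g e_h] := (dvdp_gcdl g h, dvdp_gcdr g h).
set e := gcdp g h in e_g e_h; have e0 : e != 0 by rewrite gcdp_eq0 negb_and h0 orbT.
have hE := divpK e_h; have gE := divpK e_g; set h' := (h %/ e)%R in hE; set g' := (g %/ e)%R in gE.
have cop : coprimep h' g'.
  by rewrite coprimep_sym; apply: coprimep_div_gcd; rewrite h0 orbT.
have h'd n : (h' ^+ n %| d)%R.
  have := hd n; rewrite -hE -gE !exprMn mulrA dvdp_mul2r ?expf_neq0 //.
  by rewrite Gauss_dvdpl // coprimep_expl // coprimep_expr.
have h'0 : h' != 0 by apply: contraNneq h0 => h'0; rewrite -hE h'0 mul0r.
have /size_poly1P[c c0 h'c] : size h' == 1.
  have sv : (size (h' ^+ size d)%R <= size d)%N := dvdp_leq d0 (h'd (size d)).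
  have sE := size_exp h' (size d); have d_gt0 : (0 < size d)%N by rewrite size_poly_gt0.
  rewrite eqn_leq size_poly_gt0 h'0 andbT leqNgt; apply/negP => h'2.
  have : (size d <= (size (h' ^+ size d)%R).-1)%N by rewrite sE leq_pmull // -subn1 subn_gt0.
  by rewrite -(leq_add2r 1) !addn1 prednK ?size_poly_gt0 ?expf_neq0 // ltnNge sv.
have hc : h = c *: e by rewrite -mul_polyC -h'c hE.
by rewrite [X in (X %| _)%R]hc dvdpZl.
Qed.

Definition completely_integrally_closed_in (K : fieldType) (E B : {pred K}) :=
  forall x d, x \in E -> d \in B -> d != 0 -> (forall n, d * x ^+ n \in B) -> x \in B.

Section Adjoin.

Variables (K : fieldType) (E : divringClosed K) (t : K).

Definition adjoin : {pred K} := fun x => `[< exists p q : {poly K},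
  [/\ p \is a polyOver E, q \is a polyOver E, q.[t] != 0 & x = p.[t] / q.[t]] >].

Fact adjoin_divring : divring_closed adjoin.
Proof.
split.
- by apply/asboolP; exists 1, 1; rewrite !rpred1 !hornerE ?invr1 ?mulr1 oner_neq0.
- move=> _ _ /asboolP[p [q [pE qE q0 ->]]] /asboolP[p' [q' [pE' qE' q0' ->]]].
  apply/asboolP; exists (p * q' - p' * q), (q * q').
  by rewrite !(rpredB, rpredM) // !hornerE mulf_neq0 // -mulNr addf_div // mulNr.
- move=> _ _ /asboolP[p [q [pE qE q0 ->]]] /asboolP[p' [q' [pE' qE' q0' ->]]].
  apply/asboolP; have [p'0|p'0] := eqVneq p'.[t] 0.
    by exists 0, 1; rewrite p'0 mul0r invr0 mulr0 rpred0 rpred1 !hornerE oner_neq0.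
  by exists (p * q'), (q * p'); rewrite !rpredM // !hornerE mulf_neq0 // invf_div mulf_div.
Qed.

HB.instance Definition _ := GRing.isDivringClosed.Build K adjoin adjoin_divring.

Lemma adjoin_poly (p : {poly K}) : p \is a polyOver E -> p.[t] \in adjoin.
Proof.
by move=> pE; apply/asboolP; exists p, 1; rewrite rpred1 !hornerE ?invr1 ?mulr1 oner_neq0.
Qed.

Lemma adjoin_gen : t \in adjoin.
Proof. by rewrite -[X in X \in _]hornerX adjoin_poly ?polyOverX. Qed.

Lemma adjoin_base x : x \in E -> x \in adjoin.
Proof. by move=> xE; rewrite -[x](hornerC x t) adjoin_poly ?polyOverC. Qed.

End Adjoin.

Section Residue.

Variables (K : fieldType) (E : divringClosed K) (t : K).
Hypothesis tE : transcendental_over E t.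
Variables (w : K) (wE : w \in E).

(** The graph of the evaluation at [t = - w] of rational functions in [t] over [E] without a pole
there. A relation spares the choice of numerator and denominator. *)
Definition residue (z c : K) := exists p q : {poly K},
  [/\ p \is a polyOver E, q \is a polyOver E, q.[- w] != 0,
      z = p.[t] / q.[t] & c = p.[- w] / q.[- w]].

Lemma transcendental_horner_neq0 (q : {poly K}) : q \is a polyOver E -> q != 0 -> q.[t] != 0.
Proof. by move=> qE; apply: contra_neq => /(tE qE). Qed.

Let den_neq0 (q : {poly K}) : q \is a polyOver E -> q.[- w] != 0 -> q.[t] != 0.
Proof.
move=> qE q0; apply: transcendental_horner_neq0 => //.
by apply: contraNneq q0 => ->; rewrite horner0.
Qed.

Lemma residue_frac (p q : {poly K}) : p \is a polyOver E -> q \is a polyOver E ->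
  q.[- w] != 0 -> residue (p.[t] / q.[t]) (p.[- w] / q.[- w]).
Proof. by exists p, q. Qed.

Lemma residue_poly (p : {poly K}) : p \is a polyOver E -> residue p.[t] p.[- w].
Proof. by move=> pE; exists p, 1; rewrite !hornerE ?invr1 ?mulr1 rpred1 oner_neq0. Qed.

Lemma residue_const c : c \in E -> residue c c.
Proof. by move=> cE; have := @residue_poly c%:P; rewrite !hornerC polyOverC; apply. Qed.

Lemma residue_local : residue (t + w) 0.
Proof.
by have := @residue_poly ('X + w%:P); rewrite polyOverXaddC !hornerE addNr; apply.
Qed.

Lemma residueD x y c d : residue x c -> residue y d -> residue (x + y) (c + d).
Proof.
move=> [p [q [pE qE q0 -> ->]]] [p' [q' [pE' qE' q0' -> ->]]].
exists (p * q' + p' * q), (q * q').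
rewrite rpredD ?rpredM // !hornerE mulf_neq0 //.
by rewrite !addf_div // den_neq0.
Qed.

Lemma residueM x y c d : residue x c -> residue y d -> residue (x * y) (c * d).
Proof.
move=> [p [q [pE qE q0 -> ->]]] [p' [q' [pE' qE' q0' -> ->]]].
exists (p * p'), (q * q').
by rewrite !rpredM // !hornerM mulf_neq0 // !mulf_div.
Qed.

Lemma residueX x c n : residue x c -> residue (x ^+ n) (c ^+ n).
Proof.
move=> xc; elim: n => [|n IH]; first by apply: residue_const; exact: rpred1.
by rewrite !exprS; apply: residueM.
Qed.

Lemma residue_sum n (x c : 'I_n -> K) :
  (forall i, residue (x i) (c i)) -> residue (\sum_i x i) (\sum_i c i).
Proof.
move=> xc; apply: (big_ind2 residue) => //; first by apply: residue_const; exact: rpred0.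
by move=> *; apply: residueD.
Qed.

Lemma residue_uniq x c d : residue x c -> residue x d -> c = d.
Proof.
move=> [p [q [pE qE q0 -> ->]]] [p' [q' [pE' qE' q0' + ->]]].
move=> /eqP; rewrite eqr_div ?den_neq0 // -!hornerM => /eqP.
move/(transcendental_poly_eq tE) => /(_ (rpredM pE qE') (rpredM pE' qE)).
move/(congr1 (horner^~ (- w))); rewrite /= !hornerM => pq.
by apply/eqP; rewrite eqr_div // pq.
Qed.

Lemma residue_in x c : residue x c -> c \in E.
Proof.
by move=> [p [q [pE qE _ _ ->]]]; rewrite rpred_div // rpred_horner // rpredN.
Qed.

Lemma residue_polar_poly (p : {poly K}) m : p \is a polyOver E -> (size p <= m.+1)%N ->
  residue (p.[(t + w)^-1] * (t + w) ^+ m) p`_m.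
Proof.
move=> pE sp; have tw := transcendental_addr_neq0 tE wE.
have -> : p.[(t + w)^-1] * (t + w) ^+ m = \sum_(j < m.+1) p`_j * (t + w) ^+ (m - j).
  rewrite (horner_coef_wide _ sp) mulr_suml; apply: eq_bigr => j _.
  rewrite -mulrA; congr (_ * _).
  have -> : (t + w) ^+ m = (t + w) ^+ j * (t + w) ^+ (m - j).
    by rewrite -exprD subnKC // -ltnS.
  by rewrite mulrA exprVn mulVf ?mul1r // expf_neq0.
have -> : p`_m = \sum_(j < m.+1) p`_j * 0 ^+ (m - j).
  rewrite big_ord_recr /= subnn mulr1 big1 ?add0r // => j _.
  by rewrite expr0n subn_eq0 leqNgt ltn_ord mulr0.
apply: residue_sum => j; apply: residueM; last exact/residueX/residue_local.
by apply: residue_const; apply: (polyOverP pE).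
Qed.

End Residue.

(** * Complete integral closedness of rings of partial fractions *)

(** The degrees in an equation p * u ^ n * f ^ k = q * f ^ j with [q] no longer than f ^ k. *)
Lemma degree_equation_absurd (a b c e m : nat) :
  (0 < a -> m < b -> 0 < c -> e <= c -> ((a + b).-1 + c).-1 = (e + m).-1 -> False)%N.
Proof. lia. Qed.

Section Normality.

Variables (K : fieldType) (E : divringClosed K) (B C : subringClosed K).
Variables (W : seq K) (t : K).
Hypotheses (Wuniq : uniq W) (W0 : 0 \in W) (WE : {subset W <= E}).
Hypothesis tE : transcendental_over E t.
Hypothesis BE : {subset B <= E}.
Hypothesis WB : {in W &, forall u w, u != w -> (u - w)^-1 \in B}.
Hypotheses (BC : {subset B <= C}) (WC : forall w, w \in W -> polar t w \in C).
Hypothesis C_ind : forall X : K -> Prop,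
  (forall b, b \in B -> X b) -> (forall w, w \in W -> X (polar t w)) ->
  (forall x y, X x -> X y -> X (x + y)) -> (forall x y, X x -> X y -> X (x * y)) ->
  forall z, z \in C -> X z.

Lemma polyOver_MXaddC (R : subringClosed K) (p : {poly K}) c :
  p * 'X + c%:P \is a polyOver R -> p \is a polyOver R /\ c \in R.
Proof.
move=> /polyOverP pcR; split; last by have := pcR 0; rewrite coefD coefMX coefC add0r.
by apply/polyOverP => i; have := pcR i.+1; rewrite coefD coefMX coefC addr0.
Qed.

Section PrincipalPart.

Variables (w : K) (wW : w \in W).

Let wE : w \in E := WE wW.
Let y := polar t w.

(** A ring of elements regular at [t = - w], given by generators so that facts about residues
can be proved by induction. *)
Inductive no_pole : K -> Prop :=
| no_pole_base b : b \in B -> no_pole b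
| no_pole_polar u : u \in W -> u != w -> no_pole (polar t u)
| no_poleD x z : no_pole x -> no_pole z -> no_pole (x + z)
| no_poleM x z : no_pole x -> no_pole z -> no_pole (x * z).

Lemma no_pole_residue o : no_pole o ->
  exists beta, [/\ beta \in B, residue E t w o beta & no_pole (y * (o - beta))].
Proof.
elim=> [b bB|u uW uw|x z _ [c [cB xc yx]] oz [d [dB zd yz]]|x z ox [c [cB xc yx]] _ [d [dB zd yz]]].
- exists b; rewrite subrr mulr0; split=> //; last exact: no_pole_base (rpred0 _).
  by apply: residue_const; apply: BE.
- have wu0 : u - w != 0 by rewrite subr_eq0.
  have tu := transcendental_addr_neq0 tE (WE uW); have tw := transcendental_addr_neq0 tE wE.
  exists (u - w)^-1; split; first exact: WB.
  + have := @residue_frac _ E t w 1 ('X + u%:P); rewrite rpred1 polyOverXaddC (WE uW).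
    by rewrite !hornerE [- w + u]addrC ?mul1r => /(_ isT isT wu0).
  + have -> : y * (polar t u - (u - w)^-1) = - (u - w)^-1 * polar t u.
      by rewrite /y /polar; field; rewrite wu0 tu tw.
    by apply: no_poleM; [apply: no_pole_base; rewrite rpredN WB|apply: no_pole_polar].
- exists (c + d); split; [exact: rpredD|exact: residueD|].
  by rewrite opprD addrACA mulrDr; apply: no_poleD.
- exists (c * d); split; [exact: rpredM|exact: residueM|].
  have -> : y * (x * z - c * d) = x * (y * (z - d)) + d * (y * (x - c)) by ring.
  by apply: no_poleD; apply: no_poleM => //; apply: no_pole_base.
Qed.

Let has_parts z := exists p o, [/\ p \is a polyOver B, no_pole o & z = p.[y] + o].

Let no_pole_parts o : no_pole o -> has_parts o.
Proof. by exists 0, o; rewrite rpred0 horner0 add0r. Qed.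

Let has_partsD x z : has_parts x -> has_parts z -> has_parts (x + z).
Proof.
move=> [p [o [pB oO ->]]] [p' [o' [pB' oO' ->]]]; exists (p + p'), (o + o').
by rewrite rpredD // hornerD addrACA; split=> //; apply: no_poleD.
Qed.

Let has_parts_polarM x : has_parts x -> has_parts (y * x).
Proof.
move=> [p [o [pB oO ->]]]; have [beta [betaB _ yo]] := no_pole_residue oO.
exists (p * 'X + beta%:P * 'X), (y * (o - beta)).
rewrite rpredD ?rpredM ?polyOverX ?polyOverC // !hornerE; split=> //.
by ring.
Qed.

Let has_parts_no_poleM o x : no_pole o -> has_parts x -> has_parts (o * x).
Proof.
move=> oO [p [o' [pB oO' ->]]]; rewrite mulrDr.
apply: has_partsD; last by apply: no_pole_parts; apply: no_poleM.
elim/poly_ind: p pB => [|p c IH] pcB.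
  by rewrite horner0 mulr0; apply/no_pole_parts/no_pole_base/rpred0.
have [pB cB] := polyOver_MXaddC pcB.
rewrite !hornerE mulrDr; apply: has_partsD; last first.
  by apply: no_pole_parts; apply: no_poleM => //; apply: no_pole_base.
by rewrite mulrA mulrC; apply: has_parts_polarM; apply: IH.
Qed.

Let has_partsM x z : has_parts x -> has_parts z -> has_parts (x * z).
Proof.
move=> [p [o [pB oO ->]]] zP; rewrite mulrDl.
apply: has_partsD; last exact: has_parts_no_poleM.
elim/poly_ind: p pB => [|p c IH] pcB.
  by rewrite horner0 mul0r; apply/no_pole_parts/no_pole_base/rpred0.
have [pB cB] := polyOver_MXaddC pcB.
rewrite !hornerE mulrDl; apply: has_partsD.
  by rewrite mulrAC mulrC; apply: has_parts_polarM; apply: IH.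
by apply: has_parts_no_poleM => //; apply: no_pole_base.
Qed.

Lemma principal_part z : z \in C ->
  exists p o, [/\ p \is a polyOver B, no_pole o & z = p.[y] + o].
Proof.
move: z; apply: C_ind => //.
- by move=> b bB; apply/no_pole_parts/no_pole_base.
- move=> u uW; have [->|uw] := eqVneq u w; last exact/no_pole_parts/no_pole_polar.
  exists 'X, 0; rewrite polyOverX hornerX addr0; split=> //; exact/no_pole_base/rpred0.
Qed.

(** Up to the value of the regular part, which is in [B], [c] is a coefficient of the principal
part. *)
Lemma residue_pole z k c : z \in C -> residue E t w (z * (t + w) ^+ k) c -> c \in B.
Proof.
move=> zC zc; have [p [o [pB oO zE]]] := principal_part zC.
have [beta [betaB ob _]] := no_pole_residue oO.
have pE : p \is a polyOver E by apply: polyOverS pB.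
have zm m : (size p <= m.+1)%N -> residue E t w (z * (t + w) ^+ m) (p`_m + beta * 0 ^+ m).
  move=> sp; rewrite zE mulrDl; apply: residueD => //; first exact: residue_polar_poly.
  by apply: residueM => //; apply: residueX; apply: residue_local.
have [sp|kp] := leqP (size p) k.+1.
  rewrite (residue_uniq tE zc (zm k sp)) rpredD ?rpredM ?rpredX ?rpred0 //.
  exact: (polyOverP pB).
have p0 : p != 0 by rewrite -size_poly_gt0 (leq_trans _ kp).
have sp1 : ((size p).-1.+1 = size p)%N by rewrite prednK // size_poly_gt0.
have nk : (k < (size p).-1)%N by rewrite -ltnS sp1.
have := zm (size p).-1; rewrite sp1 => /(_ (leqnn _)).
rewrite expr0n -leqn0 leqNgt (leq_trans _ nk) // mulr0 addr0 => zlead.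
have zlead0 : residue E t w (z * (t + w) ^+ (size p).-1) (c * 0 ^+ ((size p).-1 - k)).
  rewrite -(subnKC (ltnW nk)) exprD mulrA addKn; apply: residueM => //.
  by apply: residueX; apply: residue_local.
have := residue_uniq tE zlead zlead0.
rewrite expr0n subn_eq0 leqNgt nk mulr0 => /eqP.
by rewrite -/(lead_coef p) lead_coef_eq0 (negPf p0).
Qed.

End PrincipalPart.

Let f : {poly K} := \prod_(w <- W) ('X + w%:P).

Let fE : f \is a polyOver E. Proof. exact: (polar_prod_over WE). Qed.
Let ft0 : f.[t] != 0. Proof. exact: (polar_prod_neq0 WE tE). Qed.

Let f_monic : f \is monic.
Proof. by apply: monic_prod => w _; rewrite -[w]opprK polyCN monicXsubC. Qed.

Let f_split w : w \in W -> exists g, [/\ g \is a polyOver E, f = ('X + w%:P) * g & g.[- w] != 0].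
Proof.
move=> wW; exists (\prod_(u <- W | u != w) ('X + u%:P)); split.
- by rewrite big_seq_cond; apply: rpred_prod => u /andP[/WE]; rewrite polyOverXaddC.
- by rewrite /f (bigD1_seq w).
- rewrite horner_prod prodf_seq_neq0; apply/allP => u _.
  by apply/implyP => uw; rewrite !hornerE addrC subr_eq0.
Qed.

Let has_numerator z := exists (p : {poly K}) k,
  [/\ p \is a polyOver E, (size p <= size (f ^+ k)%R)%N & z = p.[t] / f.[t] ^+ k].

Let numerator z : z \in C -> has_numerator z.
Proof.
have fX0 k : (0 < size (f ^+ k)%R)%N by rewrite size_poly_gt0 monic_neq0 ?monic_exp.
have szM (p q : {poly K}) k l : (size p <= size (f ^+ k)%R)%N -> (size q <= size (f ^+ l)%R)%N ->
    (size (p * q)%R <= size (f ^+ (k + l))%R)%N.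
  move=> sp sq; apply: leq_trans (size_polyMleq _ _) _.
  have pred_leq a b : (a <= b -> a.-1 <= b.-1)%N by lia.
  rewrite exprD size_Mmonic ?monic_exp ?monic_neq0 ?monic_exp //.
  by apply: pred_leq; apply: leq_add.
move: z; apply: C_ind => [b bB|w wW|x z [p [k [pE sp ->]]] [q [l [qE sq ->]]]
                                   |x z [p [k [pE sp ->]]] [q [l [qE sq ->]]]].
- exists b%:P, 0; rewrite polyOverC BE // hornerC divr1 size_poly1; split=> //.
  exact: size_polyC_leq1.
- have [g [gE fg _]] := f_split wW; exists g, 1; rewrite !expr1; split=> //.
    have g0 : g != 0 by apply: contraTneq (monic_neq0 f_monic) => g0; rewrite fg g0 mulr0 eqxx.
    by rewrite dvdp_leq ?monic_neq0 // fg dvdp_mull.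
  have g0 : g.[t] != 0 by move: ft0; rewrite fg hornerM mulf_eq0 negb_or => /andP[].
  by rewrite fg !hornerE invfM mulrCA divff // mulr1.
- exists (p * f ^+ l + q * f ^+ k), (k + l)%N; split.
  + by rewrite rpredD ?rpredM ?rpredX.
  + rewrite (leq_trans (size_polyD _ _)) // geq_max.
    by rewrite szM //= addnC szM.
  + by rewrite !hornerE addf_div ?expf_neq0 // exprD.
- exists (p * q), (k + l)%N; split; first exact: rpredM.
  + exact: szM.
  + by rewrite hornerM mulf_div exprD.
Qed.

Hypothesis cicB : completely_integrally_closed_in E B.

Section AlmostIntegral.

Variables (d : K) (dC : d \in C) (d0 : d != 0).

(** After division by powers of [t + w], the elements [d * x ^+ n] have residues [lam * c ^+ n] at
[- w] for some [lam <> 0], and all of these are in [B]. *)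
Lemma residue_almost_integral w x k c : w \in W -> (forall n, d * x ^+ n \in C) ->
  residue E t w (x * (t + w) ^+ k) c -> c \in B.
Proof.
move=> wW dx xc; have wE := WE wW; have tw := transcendental_addr_neq0 tE wE.
have [p [j [pE _ dE]]] := numerator dC; have [g [gE fg gw]] := f_split wW.
have p0 : p != 0 by apply: contraNneq d0 => p0; rewrite dE p0 horner0 mul0r.
have NwE : - w \in E by rewrite rpredN.
have [i [q [qE qw pq]]] := polyOver_multiplicity pE NwE p0.
pose lam := q.[- w] / g.[- w] ^+ j.
have lam0 : lam != 0 by rewrite mulf_neq0 ?invr_eq0 ?expf_neq0.
have dlam : residue E t w (d * polar t w ^+ i * (t + w) ^+ j) lam.
  have gX : (g ^+ j).[- w] != 0 by rewrite horner_exp expf_neq0.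
  have := residue_frac t qE (rpredX j gE) gX; rewrite !horner_exp -/lam.
  congr residue; rewrite dE pq fg polyCN opprK !hornerE /polar.
  have gt0 : g.[t] != 0 by move: ft0; rewrite fg hornerM mulf_eq0 negb_or => /andP[].
  rewrite exprMn exprVn.
  have := expf_neq0 i tw; have := expf_neq0 j tw; have := expf_neq0 j gt0.
  move: ((t + w) ^+ i) ((t + w) ^+ j) (g.[t] ^+ j) => u v r r0 v0 u0.
  by field; rewrite r0 v0 u0.
have lamc n : lam * c ^+ n \in B.
  apply: (@residue_pole w wW (d * polar t w ^+ i * x ^+ n) (j + k * n)).
    by rewrite mulrAC rpredM ?rpredX ?WC.
  rewrite exprD exprM mulrACA -exprMn; apply: residueM => //.
  exact: residueX.
apply: (cicB (d := lam)) => //; first exact: residue_in xc.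
by have := lamc 0; rewrite mulr1.
Qed.

(** The elements of [C] are bounded at infinity, so no positive power of [t] survives. *)
Lemma almost_integral_poly (u : {poly K}) : u \is a polyOver E ->
  (forall n, d * u.[t] ^+ n \in C) -> u.[t] \in C.
Proof.
move=> uE du; have [p [j [pE _ dE]]] := numerator dC.
have p0 : p != 0 by apply: contraNneq d0 => p0; rewrite dE p0 horner0 mul0r.
have su : (size u <= 1)%N.
  set n := size (f ^+ j); have [q [k [qE sq duE]]] := numerator (du n).
  have pq : p * u ^+ n * f ^+ k = q * f ^+ j.
    apply: (transcendental_poly_eq tE); rewrite ?rpredM ?rpredX //.
    rewrite !hornerE; move/eqP: duE; rewrite dE mulrAC eqr_div ?expf_neq0 // => /eqP ->.
    by rewrite mulrC.
  have fX0 l : f ^+ l != 0 by rewrite monic_neq0 ?monic_exp.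
  rewrite leqNgt; apply/negP => su; have u0 : u != 0 by rewrite -size_poly_gt0 ltnW.
  have un0 := expf_neq0 n u0; have pu0 : p * u ^+ n != 0 by rewrite mulf_neq0.
  have q0 : q != 0.
    by apply: contraNneq (mulf_neq0 pu0 (fX0 k)) => q0; rewrite pq q0 mul0r.
  have := congr1 (fun r : {poly K} => size r) pq; rewrite /= !size_mul //.
  apply: degree_equation_absurd; rewrite ?size_poly_gt0 //.
  rewrite -[X in (_ < X)%N]prednK ?size_poly_gt0 //.
  by rewrite ltnS size_exp leq_pmull // -subn1 subn_gt0.
have uC := size1_polyC su; rewrite uC hornerC in du *.
have u0E : u`_0 \in E by apply: (polyOverP uE).
apply/BC/(residue_almost_integral (k := 0) W0 du).
by rewrite mulr1; apply: residue_const.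
Qed.

(** Induction on the degree of the denominator [h]. A root of [h] in [- W] is a pole of [x] with
leading coefficient in [B], and subtracting the polar term lowers the degree of [h]. Without
such roots, [h] is prime to the denominators available in [C], so it divides [g]. *)
Lemma almost_integral_frac N (g h : {poly K}) :
    g \is a polyOver E -> h \is a polyOver E -> h != 0 -> (size h <= N)%N ->
    (forall n, d * (g.[t] / h.[t]) ^+ n \in C) -> g.[t] / h.[t] \in C.
Proof.
elim: N g h => [|N IH] g h gE hE h0; first by rewrite leqn0 size_poly_eq0 (negPf h0).
move=> sh dx; set x := _ / _ in dx *.
have ht0 := transcendental_horner_neq0 tE hE h0.
have [/hasP[w wW /eqP hw]|noroot] := boolP (has (fun w => h.[- w] == 0) W).
- have wE := WE wW; have NwE : - w \in E by rewrite rpredN.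
  have tw := transcendental_addr_neq0 tE wE.
  have [k [h1 [h1E h1w hh1]]] := polyOver_multiplicity hE NwE h0.
  rewrite polyCN opprK in hh1.
  case: k => [|k] in hh1; first by rewrite hh1 mulr1 in hw; rewrite hw eqxx in h1w.
  have h1t0 : h1.[t] != 0.
    by apply: (transcendental_horner_neq0 tE h1E); apply: contraNneq h1w => ->; rewrite horner0.
  set c := g.[- w] / h1.[- w].
  have xc : residue E t w (x * (t + w) ^+ k.+1) c.
    have := residue_frac t gE h1E h1w; congr residue.
    by rewrite /x hh1 !hornerE invfM -!mulrA mulVf ?mulr1 // expf_neq0.
  have cB := residue_almost_integral wW dx xc.
  have yC : c * polar t w ^+ k.+1 \in C by rewrite rpredM ?rpredX ?WC ?BC.
  have [g2 [g2E gg2]] : exists g2, g2 \is a polyOver E /\ g - c%:P * h1 = g2 * ('X - (- w)%:P).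
    apply: polyOver_factor => //; first by rewrite rpredB ?rpredM // polyOverC BE.
    by rewrite !hornerE /c divfK // subrr.
  rewrite polyCN opprK in gg2.
  set h3 := h1 * ('X + w%:P) ^+ k.
  have hh3 : h = h3 * ('X + w%:P) by rewrite hh1 exprSr mulrA.
  have h3E : h3 \is a polyOver E by rewrite rpredM ?rpredX // polyOverXaddC.
  have h30 : h3 != 0 by apply: contraNneq h0 => h30; rewrite hh3 h30 mul0r.
  have h3t0 := transcendental_horner_neq0 tE h3E h30.
  have xE : x - c * polar t w ^+ k.+1 = g2.[t] / h3.[t].
    have -> : g2.[t] = (g.[t] - c * h1.[t]) / (t + w).
      have := congr1 (horner^~ t) gg2; rewrite /= !hornerE => ->; by rewrite mulfK.
    rewrite /x /h3 hh1 /polar !hornerE exprSr exprVn exprS.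
    have := expf_neq0 k tw; move: (_ ^+ k) => v v0.
    by field; rewrite v0 tw h1t0.
  rewrite -(subrK (c * polar t w ^+ k.+1) x) rpredD // xE; apply: IH => //.
    have := sh; rewrite hh3 size_Mmonic //; last by rewrite -[w]opprK polyCN monicXsubC.
    by rewrite -[w]opprK polyCN size_XsubC addn2.
  move=> n; rewrite -xE exprBn mulr_sumr; apply: rpred_sum => i _.
  rewrite mulrnAr; apply: rpredMn; rewrite -mulrA mulrCA [d * _]mulrA.
  apply: rpredM; first by rewrite rpredX ?rpredN ?rpred1.
  by apply: rpredM; [exact: dx|exact: rpredX].
- have cop : coprimep h f.
    rewrite /f big_seq; apply: (big_ind (fun q => coprimep h q)) => [|p q hp hq|w wW].
    + exact: coprimep1.
    + by rewrite coprimepMr hp.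
    + rewrite -[w]opprK polyCN coprimep_XsubC; apply: contra noroot => hw.
      by apply/hasP; exists w.
  have [p [j [pE _ dE]]] := numerator dC.
  have p0 : p != 0 by apply: contraNneq d0 => p0; rewrite dE p0 horner0 mul0r.
  have hg : (h %| g)%R.
    apply: (dvdp_of_dvdp_exp p0 h0) => n; have [q [k [qE sq dxE]]] := numerator (dx n).
    have pq : p * g ^+ n * f ^+ k = q * f ^+ j * h ^+ n.
      apply: (transcendental_poly_eq tE); rewrite ?rpredM ?rpredX //.
      rewrite !hornerE; move/eqP: dxE.
      rewrite dE /x expr_div_n mulf_div eqr_div ?mulf_neq0 ?expf_neq0 // => /eqP ->.
      by rewrite mulrA.
    have : (h ^+ n %| p * g ^+ n * f ^+ k)%R by rewrite pq dvdp_mull.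
    by rewrite Gauss_dvdpl // coprimep_expl // coprimep_expr.
  have [u [v [uE vE gE' sv]]] := polyOver_edivp gE hE h0.
  have v0 : v = 0.
    apply/eqP; apply: contraTT sv => v0; rewrite -leqNgt dvdp_leq //.
    have -> : v = g - u * h by rewrite gE' addrC addKr.
    by rewrite dvdp_sub // dvdp_mull.
  have xu : x = u.[t] by rewrite /x gE' v0 addr0 hornerM mulfK.
  by rewrite xu in dx *; apply: almost_integral_poly.
Qed.

End AlmostIntegral.

Lemma completely_integrally_closed_adjoin : completely_integrally_closed_in (adjoin E t) C.
Proof.
move=> x d /asboolP[p [q [pE qE q0 ->]]] dC d0 dx.
have q0' : q != 0 by apply: contraNneq q0 => ->; rewrite horner0.
exact: (almost_integral_frac dC d0 pE qE q0' (leqnn _) dx).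
Qed.

End Normality.

(** * The tower of rings of a flag *)

Section Tower.

Variables (F : finFieldType) (V : vectType F).

Local Notation S := (SymV V).
Local Notation K := (KV V).
Local Notation r := (\dim {:V}).
Local Notation bas := (vbasis {:V}).

Definition scal (c : F) : K := tofrac (c%:A : S).
Definition lform (v : V) : K := tofrac (symV v).
(** Indexed by all natural numbers, with value 0 beyond the dimension, so that the tower can be
built by recursion. *)
Definition gen_var (n : nat) : S := if insub n is Some i then 'X_i : {mpoly F[r]} else 0.
Definition gen (n : nat) : K := tofrac (gen_var n).

Fact scal_is_zmod : zmod_morphism scal.
Proof. by move=> a b; rewrite /scal scalerBl rmorphB. Qed.

Fact scal_is_monoid : monoid_morphism scal.
Proof.
by split=> [|a b]; rewrite /scal ?scale1r ?rmorph1 // -rmorphM -scalerAl mul1r scalerA.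
Qed.

HB.instance Definition _ := GRing.isZmodMorphism.Build F K scal scal_is_zmod.
HB.instance Definition _ := GRing.isMonoidMorphism.Build F K scal scal_is_monoid.

Lemma lformD u v : lform (u + v) = lform u + lform v.
Proof. by rewrite /lform linearD rmorphD. Qed.

Lemma lformZ c v : lform (c *: v) = scal c * lform v.
Proof. by rewrite /lform /scal linearZ -rmorphM -scalerAl mul1r. Qed.

Lemma lformB u v : lform (u - v) = lform u - lform v.
Proof. by rewrite /lform linearB rmorphB. Qed.

Lemma symV_basis (i : 'I_r) : symV bas`_i = gen_var i.
Proof.
rewrite /gen_var valK /symV (bigD1 i) //= big1 => [|j ji].
  by rewrite coord_free ?eqxx ?scale1r ?addr0 // (basis_free (vbasisP _)).
rewrite coord_free ?(basis_free (vbasisP _)) //.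
by rewrite eq_sym (negPf ji) scale0r.
Qed.

Lemma lform_sum v : lform v = \sum_(i < r) scal (coord bas i v) * gen i.
Proof.
rewrite /lform {1}(coord_vbasis (memvf v)) linear_sum rmorph_sum; apply: eq_bigr => i _.
by rewrite linearZ /= symV_basis /scal /gen -rmorphM -scalerAl mul1r.
Qed.

Lemma lform_eq0 v : (lform v == 0) = (v == 0).
Proof.
apply/eqP/eqP => [/eqP|->]; last by rewrite /lform linear0 rmorph0.
rewrite /lform tofrac_eq0 => /eqP v0; rewrite (coord_vbasis (memvf v)) big1 // => i _.
have := congr1 (mcoeff U_(i)) v0; rewrite /symV mcoeff0 linear_sum (bigD1 i) //= big1.
  by rewrite addr0 mcoeffZ mcoeffXU eqxx mulr1 => ->; rewrite scale0r.
by move=> j /negPf ji; rewrite mcoeffZ mcoeffXU ji mulr0.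
Qed.

(** The span of the first [n] basis vectors. *)
Definition in_flag (n : nat) (v : V) : bool :=
  [forall j : 'I_r, (n <= j)%N ==> (coord bas j v == 0)].

Lemma in_flagP n v : reflect (forall j : 'I_r, (n <= j)%N -> coord bas j v = 0) (in_flag n v).
Proof.
apply: (iffP forallP) => [h j nj|h j]; first by have /implyP/(_ nj)/eqP := h j.
by apply/implyP => /h ->.
Qed.

Lemma in_flag_dim v : in_flag r v.
Proof. by apply/in_flagP => j; rewrite leqNgt ltn_ord. Qed.

Lemma in_flag0 n : in_flag n 0.
Proof. by apply/in_flagP => j _; rewrite linear0. Qed.

Lemma in_flagB n u v : in_flag n u -> in_flag n v -> in_flag n (u - v).
Proof.
by move=> /in_flagP u0 /in_flagP v0; apply/in_flagP => j nj; rewrite linearB /= u0 ?v0 ?subr0.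
Qed.

Definition vectors : seq V := [seq \sum_(i < r) c i *: bas`_i | c : {ffun 'I_r -> F}].

Lemma mem_vectors v : v \in vectors.
Proof.
apply/mapP; exists [ffun i => coord bas i v]; first by rewrite mem_enum.
by rewrite {1}(coord_vbasis (memvf v)); apply: eq_bigr => i _; rewrite ffunE.
Qed.

Definition flag_forms (n : nat) : seq K := undup [seq lform v | v <- vectors & in_flag n v].

Lemma flag_formsP n w : reflect (exists2 v, in_flag n v & w = lform v) (w \in flag_forms n).
Proof.
rewrite mem_undup; apply: (iffP mapP) => [[v]|[v vn ->]].
  by rewrite mem_filter => /andP[vn _] ->; exists v.
by exists v => //; rewrite mem_filter vn mem_vectors.
Qed.

Definition flag_ring (n : nat) : {pred K} := fun x => `[< subalgebra_gen scal
  (fun y => exists v, [/\ v != 0, in_flag n v & y = (lform v)^-1]) x >].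

Lemma flag_ring_scal n c : scal c \in flag_ring n.
Proof. exact/asboolP/subalgebra_gen_scalar. Qed.

Lemma flag_ring_inv n v : in_flag n v -> (lform v)^-1 \in flag_ring n.
Proof.
move=> vn; have [->|v0] := eqVneq v 0.
  have /eqP -> : lform 0 == 0 by rewrite lform_eq0.
  by rewrite invr0 -(rmorph0 scal) flag_ring_scal.
by apply/asboolP/subalgebra_gen_mem; exists v.
Qed.

Fact flag_ring_subring n : subring_closed (flag_ring n).
Proof.
split=> [|x y|x y].
- by rewrite -(rmorph1 scal) flag_ring_scal.
- move=> /asboolP xB /asboolP yB; apply/asboolP/subalgebra_gen_add => //.
  rewrite -mulN1r -(rmorph1 scal) -rmorphN; apply: subalgebra_gen_mul => //.
  exact: subalgebra_gen_scalar.
- by move=> /asboolP xB /asboolP yB; apply/asboolP/subalgebra_gen_mul.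
Qed.

HB.instance Definition _ n := GRing.isSubringClosed.Build K (flag_ring n) (flag_ring_subring n).

Lemma flag_ring_ind n (X : K -> Prop) :
  (forall c, X (scal c)) -> (forall v, v != 0 -> in_flag n v -> X (lform v)^-1) ->
  (forall x y, X x -> X y -> X (x + y)) -> (forall x y, X x -> X y -> X (x * y)) ->
  forall z, z \in flag_ring n -> X z.
Proof.
move=> Xs Xv XD XM z /asboolP; elim=> //.
- by move=> _ [v [v0 vn ->]]; apply: Xv.
- by move=> x y _ Xx _; apply: XD.
- by move=> x y _ Xx _; apply: XM.
Qed.

Lemma flag_ring_mono n m : (n <= m)%N -> {subset flag_ring n <= flag_ring m}.
Proof.
move=> nm; apply: flag_ring_ind => [c|v v0 /in_flagP vn|x y xB yB|x y xB yB].
- exact: flag_ring_scal.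
- by apply: flag_ring_inv; apply/in_flagP => j mj; apply: vn; apply: leq_trans mj.
- exact: rpredD.
- exact: rpredM.
Qed.

Lemma flag_ring_dim : flag_ring r =i @RV_pred F V.
Proof.
move=> x; apply/asboolP/asboolP.
- elim=> [c|_ [v [v0 _ ->]]|y z _ yR _ zR|y z _ yR _ zR].
  + exact: subalgebra_gen_scalar.
  + by apply: subalgebra_gen_mem; exists v.
  + exact: subalgebra_gen_add.
  + exact: subalgebra_gen_mul.
- elim=> [c|_ [v v0 ->]|y z _ yR _ zR|y z _ yR _ zR].
  + exact: subalgebra_gen_scalar.
  + by apply: subalgebra_gen_mem; exists v; rewrite in_flag_dim.
  + exact: subalgebra_gen_add.
  + exact: subalgebra_gen_mul.
Qed.

Definition scalars : {pred K} := fun x => `[< exists c, x = scal c >].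

Fact scalars_divring : divring_closed scalars.
Proof.
split=> [|_ _ /asboolP[c ->] /asboolP[d ->]|_ _ /asboolP[c ->] /asboolP[d ->]]; apply/asboolP.
- by exists 1; rewrite rmorph1.
- by exists (c - d); rewrite rmorphB.
- by exists (c / d); rewrite fmorph_div.
Qed.

HB.instance Definition _ := GRing.isDivringClosed.Build K scalars scalars_divring.

Fixpoint flag_field (n : nat) : divringClosed K :=
  if n is n'.+1 then adjoin (flag_field n') (gen n') else scalars.

Lemma flag_field_mono n m : (n <= m)%N -> {subset flag_field n <= flag_field m}.
Proof.
move=> /subnK <-; elim: (m - n)%N => // k IH x xE.
by rewrite addSn; apply: adjoin_base; apply: IH.
Qed.

Lemma flag_field_scal n c : scal c \in flag_field n.
Proof. by apply: (@flag_field_mono 0) => //; apply/asboolP; exists c. Qed.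

Lemma flag_field_gen n m : (n < m)%N -> gen n \in flag_field m.
Proof. by move=> nm; apply: (flag_field_mono nm); apply: adjoin_gen. Qed.

Lemma flag_field_lform n v : in_flag n v -> lform v \in flag_field n.
Proof.
move=> /in_flagP vn; rewrite lform_sum; apply: rpred_sum => i _.
have [/vn ->|lin] := leqP n i; first by rewrite rmorph0 mul0r rpred0.
by rewrite rpredM ?flag_field_scal ?flag_field_gen.
Qed.

Lemma flag_ring_sub_field n : {subset flag_ring n <= flag_field n}.
Proof.
apply: flag_ring_ind => [c|v v0 vn|x y xE yE|x y xE yE].
- exact: flag_field_scal.
- by rewrite rpredV flag_field_lform.
- exact: rpredD.
- exact: rpredM.
Qed.

Lemma flag_field_dim x : x \in flag_field r.
Proof.
have [a [b [_ ->]]] := fractionP x.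
suff pE (p : S) : tofrac p \in flag_field r by rewrite rpred_div.
rewrite (mpolyE (p : {mpoly F[r]})) rmorph_sum; apply: rpred_sum => m _.
rewrite -mul_mpolyC rmorphM; apply: rpredM.
  have -> : (p@_m)%:MP = (p@_m)%:A :> S by rewrite -[RHS]mul_mpolyC mulr1.
  exact: flag_field_scal.
rewrite mpolyXE_id rmorph_prod; apply: rpred_prod => i _.
rewrite rmorphXn; apply: rpredX; have := flag_field_gen (ltn_ord i).
by rewrite /gen /gen_var valK.
Qed.

End Tower.

(** * Induction along the flag *)

Section FlagTranscendence.

Variables (F : finFieldType) (V : vectType F) (i : 'I_(\dim {:V})).

Local Notation S := (SymV V).
Local Notation K := (KV V).
Local Notation r := (\dim {:V}).

(** [split_var] views a polynomial as one in the variable [i] with coefficients in the others;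
the field [var_free] of fractions of constants then does not involve this variable. *)
Definition split_var (p : S) : {poly S} :=
  mmap (polyC \o @mpolyC r F) (fun j => if j == i then 'X else ('X_j : {mpoly F[r]})%:P) p.

Fact split_var_zmod : zmod_morphism split_var.
Proof. by move=> p q; rewrite /split_var raddfB. Qed.

Fact split_var_monoid : monoid_morphism split_var.
Proof. by split; [exact: rmorph1|exact: rmorphM]. Qed.

HB.instance Definition _ := GRing.isZmodMorphism.Build S {poly S} split_var split_var_zmod.
HB.instance Definition _ := GRing.isMonoidMorphism.Build S {poly S} split_var split_var_monoid.

Lemma split_varX (j : 'I_r) : split_var (gen_var V j) = if j == i then 'X else (gen_var V j)%:P.
Proof. by rewrite /gen_var valK /split_var mmapX mmap1U. Qed.

Lemma split_varC c : split_var c%:A = (c%:A)%:P.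
Proof.
have cE : c%:A = c%:MP :> {mpoly F[r]} by rewrite -[LHS]mul_mpolyC mulr1.
by rewrite /split_var cE mmapC.
Qed.

Definition var_free : {pred K} := fun x => `[< exists a d : S,
  [/\ d != 0, split_var a = a%:P, split_var d = d%:P & x = tofrac a / tofrac d] >].

Fact var_free_divring : divring_closed var_free.
Proof.
split.
- by apply/asboolP; exists 1, 1; rewrite !rmorph1 divr1 oner_neq0.
- move=> _ _ /asboolP[a [d [d0 fa fd ->]]] /asboolP[b [e [e0 fb fe ->]]].
  apply/asboolP; exists (a * e - b * d), (d * e).
  rewrite mulf_neq0 // !(rmorphB, rmorphM) /= fa fb fd fe; split=> //.
  by rewrite -[in LHS]mulNr addf_div ?tofrac_eq0 // mulNr.
- move=> _ _ /asboolP[a [d [d0 fa fd ->]]] /asboolP[b [e [e0 fb fe ->]]].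
  apply/asboolP; have [->|b0] := eqVneq b 0.
    by exists 0, 1; rewrite !rmorph0 !rmorph1 mul0r invr0 mulr0 mul0r oner_neq0.
  exists (a * e), (d * b).
  by rewrite mulf_neq0 // !rmorphM /= fa fb fd fe invf_div mulf_div.
Qed.

HB.instance Definition _ := GRing.isDivringClosed.Build K var_free var_free_divring.

Lemma flag_field_var_free n : (n <= i)%N -> {subset flag_field V n <= var_free}.
Proof.
elim: n => [_ x /asboolP[c ->]|n IH ni x].
  by apply/asboolP; exists c%:A, 1; rewrite split_varC !rmorph1 divr1 oner_neq0.
have nr : (n < r)%N by apply: ltn_trans ni _.
have genE : gen V n \in var_free.
  apply/asboolP; exists (gen_var V n), 1; rewrite !rmorph1 divr1 oner_neq0; split=> //.
  rewrite -[n]/(nat_of_ord (Ordinal nr)) split_varX; case: eqP => // ni'.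
  by rewrite -ni' ltnn in ni.
move=> /asboolP[p [q [pE qE _ ->]]]; rewrite rpred_div // rpred_horner //.
  by apply: polyOverS pE; apply: IH; apply: ltnW.
by apply: polyOverS qE; apply: IH; apply: ltnW.
Qed.

Lemma var_free_common_denominator (l : seq K) : {subset l <= var_free} ->
  exists d : S, [/\ d != 0, split_var d = d%:P & forall x, x \in l ->
    exists a, split_var a = a%:P /\ tofrac d * x = tofrac a].
Proof.
elim: l => [|x l IH] lE; first by exists 1; rewrite oner_neq0 !rmorph1.
have [|d [d0 fd dl]] := IH; first by move=> y yl; apply: lE; rewrite inE yl orbT.
have /asboolP[a [e [e0 fa fe xE]]] := lE x (mem_head _ _).
exists (d * e); rewrite mulf_neq0 // !rmorphM /= fd fe; split=> // y.
rewrite inE => /orP[/eqP ->|/dl[b [fb yE]]].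
  exists (d * a); rewrite !rmorphM /= fd fa; split=> //.
  by rewrite xE -mulrA [tofrac e * _]mulrC divfK ?tofrac_eq0.
exists (b * e); rewrite !rmorphM /= fb fe; split=> //.
by rewrite mulrAC yE.
Qed.

Lemma flag_field_transcendental : transcendental_over (flag_field V i) (gen V i).
Proof.
move=> p /(polyOverS (flag_field_var_free (leqnn _))) pE p0.
have [|d [d0 _ dp]] := @var_free_common_denominator p.
  by move=> _ /(nthP 0)[k _ <-]; apply: (polyOverP pE).
have /choice[a aP] k : exists a, split_var a = a%:P /\ tofrac d * p`_k = tofrac a.
  have [kp|pk] := ltnP k (size p); first by apply: dp; exact: mem_nth.
  by exists 0; rewrite nth_default // mulr0 !rmorph0.
have sum0 : \sum_(k < size p) a k * gen_var V i ^+ k = 0.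
  apply/eqP; rewrite -tofrac_eq0 rmorph_sum; apply/eqP.
  transitivity (tofrac d * p.[gen V i]); last by rewrite p0 mulr0.
  rewrite horner_coef mulr_sumr; apply: eq_bigr => k _.
  by rewrite rmorphM rmorphXn mulrA (aP k).2.
have := congr1 split_var sum0; rewrite rmorph0 rmorph_sum => psum0.
apply/polyP => k; rewrite coef0; have [kp|pk] := ltnP k (size p); last by rewrite nth_default.
have := congr1 (fun q : {poly S} => q`_k) psum0; rewrite coef0 coef_sum (bigD1 (Ordinal kp)) //=.
rewrite rmorphM rmorphXn /= split_varX eqxx (aP k).1 coefCM coefXn eqxx mulr1 big1 ?addr0.
  move=> ak0; have := (aP k).2; rewrite ak0 rmorph0 => /eqP.
  by rewrite mulf_eq0 tofrac_eq0 (negPf d0) => /eqP.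
move=> j jk; rewrite rmorphM rmorphXn /= split_varX eqxx (aP j).1 coefCM coefXn.
suff /negPf -> : k != j by rewrite mulr0.
by apply: contra jk => /eqP kj; apply/eqP/val_inj.
Qed.

End FlagTranscendence.

Section FlagStep.

Variables (F : finFieldType) (V : vectType F) (i : 'I_(\dim {:V})).

Local Notation K := (KV V).
Local Notation r := (\dim {:V}).
Local Notation bas := (vbasis {:V}).
Local Notation W := (flag_forms V i).
Local Notation B := (@flag_ring F V i).
Local Notation C := (@flag_ring F V i.+1).

Lemma flag_forms_uniq : uniq W. Proof. exact: undup_uniq. Qed.

Lemma flag_forms0 : 0 \in W.
Proof. by apply/flag_formsP; exists 0; [exact: in_flag0|apply/esym/eqP; rewrite lform_eq0]. Qed.

Lemma flag_forms_field : {subset W <= flag_field V i}.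
Proof. by move=> _ /flag_formsP[v vn ->]; exact: flag_field_lform. Qed.

Lemma flag_forms_inv : {in W &, forall u w, u != w -> (u - w)^-1 \in B}.
Proof.
move=> _ _ /flag_formsP[u un ->] /flag_formsP[v vn ->] _; rewrite -lformB.
by apply: flag_ring_inv; exact: in_flagB.
Qed.

Lemma coord_basis (j : 'I_r) : coord bas j bas`_i = (j == i)%:R.
Proof. by rewrite coord_free ?(basis_free (vbasisP _)) // eq_sym. Qed.

Lemma gen_addE v : gen V i + lform v = lform (bas`_i + v).
Proof. by rewrite lformD /lform symV_basis. Qed.

Lemma flag_ring_polar w : w \in W -> polar (gen V i) w \in C.
Proof.
move=> /flag_formsP[v /in_flagP vn ->]; rewrite /polar gen_addE.
apply: flag_ring_inv; apply/in_flagP => j ij; rewrite linearD /= coord_basis vn ?(ltnW ij) //.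
by case: eqP => [ji|_]; rewrite ?addr0 //; rewrite ji ltnn in ij.
Qed.

(** Up to a scalar, a vector of the next flag space is in the previous one or is the new basis
vector plus an element of it. *)
Lemma flag_ring_step_ind (X : K -> Prop) :
  (forall b, b \in B -> X b) -> (forall w, w \in W -> X (polar (gen V i) w)) ->
  (forall x y, X x -> X y -> X (x + y)) -> (forall x y, X x -> X y -> X (x * y)) ->
  forall z, z \in C -> X z.
Proof.
move=> XB XW XD XM; apply: flag_ring_ind => // [c|v v0 /in_flagP vn].
  by apply: XB; apply: flag_ring_scal.
have [a0|a0] := eqVneq (coord bas i v) 0.
  apply: XB; apply: flag_ring_inv; apply/in_flagP => j.
  rewrite leq_eqVlt => /orP[/eqP/val_inj <- //|]; exact: vn.
set a := coord bas i v in a0; set u := a^-1 *: v - bas`_i.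
have vE : v = a *: (bas`_i + u) by rewrite /u addrC subrK scalerA divff // scale1r.
rewrite vE lformZ -gen_addE invfM -fmorphV; apply: XM; first exact/XB/flag_ring_scal.
apply: XW; apply/flag_formsP; exists u => //; apply/in_flagP => j ij.
rewrite linearB linearZ /= coord_basis; have [->|ji] := eqVneq j i.
  by rewrite -/a mulVf // subrr.
by rewrite vn ?mulr0 ?subr0 // ltn_neqAle ij andbT eq_sym.
Qed.

Lemma flag_ring_step_cic :
  completely_integrally_closed_in (flag_field V i) B ->
  completely_integrally_closed_in (flag_field V i.+1) C.
Proof.
apply: completely_integrally_closed_adjoin.
- exact: flag_forms_uniq.
- exact: flag_forms0.
- exact: flag_forms_field.
- exact: flag_field_transcendental.
- exact: flag_ring_sub_field.
- exact: flag_forms_inv.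
- exact: flag_ring_mono.
- exact: flag_ring_polar.
- exact: flag_ring_step_ind.
Qed.

Lemma flag_ring_step_parameters (Q : {pred K}) : prime_in C Q ->
  prime_parameters (@scal F V) Q B i -> prime_parameters (@scal F V) Q C i.+1.
Proof.
move=> pQ; apply: (@prime_parameters_extend F K (@scal F V) B C K W
  (polar_basis (gen V i)) (polar_sum W (gen V i))) => //.
- exact: flag_ring_scal.
- exact: flag_ring_mono.
- by rewrite /polar_sum big_seq; apply: rpred_sum => w; exact: flag_ring_polar.
- by move=> w wW; rewrite /polar_basis; case: eqP => _; [exact: rpred1|exact: flag_ring_polar].
- move=> z; apply: polar_comb_span => //.
  + exact: flag_forms_uniq.
  + exact: flag_forms0.
  + exact: flag_forms_field.
  + exact: flag_field_transcendental.
  + exact: flag_forms_inv.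
  + exact: flag_ring_step_ind.
- move=> p pB p0; apply: polar_comb_free p0.
  + exact: flag_forms_uniq.
  + exact: flag_forms0.
  + exact: flag_forms_field.
  + exact: flag_field_transcendental.
  + by move=> w _; apply: polyOverS (pB w); exact: flag_ring_sub_field.
Qed.

End FlagStep.

Section FlagInduction.

Variables (F : finFieldType) (V : vectType F).

Lemma flag_ring_cic n : (n <= \dim {:V})%N ->
  completely_integrally_closed_in (flag_field V n) (@flag_ring F V n).
Proof.
elim: n => [_ x d /asboolP[c ->] _ _ _|n IH nr]; first exact: flag_ring_scal.
exact: (flag_ring_step_cic (i := Ordinal nr) (IH (ltnW nr))).
Qed.

Lemma flag_ring_parameters n (Q : {pred KV V}) : (n <= \dim {:V})%N ->
  prime_in (@flag_ring F V n) Q -> prime_parameters (@scal F V) Q (@flag_ring F V n) n.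
Proof.
elim: n => [_ pQ|n IH nr pQ]; last first.
  apply: (flag_ring_step_parameters (i := Ordinal nr) pQ); apply: IH; first exact: ltnW.
  by apply: prime_in_sub pQ; apply: flag_ring_mono.
exists [::], [::]; split=> // m c d cd /=; apply/negP => cdQ.
have cd0 : c - d != 0 by rewrite subr_eq0.
move/negP: (prime_in1 pQ); apply; have := prime_inMl pQ (flag_ring_scal V 0 (c - d)^-1) cdQ.
by rewrite -rmorphB -rmorphM mulVf // rmorph1.
Qed.

End FlagInduction.

(** * Criteria on localizations and on integral closedness *)

Lemma nonunits_ideal (R : comUnitRingType) : local_ring R -> ideal (fun x => x \in @nonunits R).
Proof.
move=> [N0 _ ND]; split=> // [x y xN yN|a x xN]; first by rewrite -[x]mul1r ND.
by rewrite -[_ * _]addr0 ND.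
Qed.

Section LocalizedSpans.

Variables (A : idomainType) (P : prime_idealr A).

Lemma span_ideal_map (R S : comNzRingType) (f : {rmorphism R -> S}) s x :
  span_ideal s x -> span_ideal (map f s) (f x).
Proof.
have [s0 sD sM] := span_ideal_ideal (map f s).
move: x; apply: span_ideal_sub => [|x xs]; last exact/mem_span_ideal/map_f.
split; first by rewrite rmorph0.
- by move=> x y fx fy; rewrite rmorphD; apply: sD.
- by move=> a x fx; rewrite rmorphM; apply: sM.
Qed.

Lemma span_ideal_loc (l : seq A) (x : localization P) a u : u \notin P ->
  x * loc_embed P u = loc_embed P a ->
  span_ideal (map (loc_embed P) l) x <-> exists t, t \notin P /\ span_ideal l (t * a).
Proof.
move=> uP xu; have [s0 sD sM] := span_ideal_ideal l.
split=> [xl|[t [tP ta]]].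
- have : exists t b, [/\ t \notin P, span_ideal l b & x * loc_embed P t = loc_embed P b].
    move: x xl {xu}; apply: span_ideal_sub => [|_ /mapP[y yl ->]]; last first.
      exists 1, y; rewrite idealr1 rmorph1 mulr1; split=> //; exact: mem_span_ideal.
    split.
    + by exists 1, 0; rewrite idealr1 rmorph1 rmorph0 mulr1.
    + move=> x y [t [b [tP bl xE]]] [v [c [vP cl yE]]]; exists (t * v), (v * b + t * c).
      rewrite prime_idealrM negb_or tP vP; split=> //; first by apply: sD; apply: sM.
      by rewrite rmorphD !rmorphM /= -xE -yE; ring.
    + move=> c x [t [b [tP bl xE]]]; have [d [v [vP cE]]] := localizationP c.
      exists (v * t), (d * b); rewrite prime_idealrM negb_or tP vP; split=> //.
        exact: sM.
      by rewrite !rmorphM /= -xE -cE; ring.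
  move=> [t [b [tP bl xE]]]; exists t; split=> //.
  suff -> : t * a = u * b by apply: sM.
  by apply: (@loc_embed_inj _ P); rewrite !rmorphM /= -xu -xE; ring.
- have tuU : loc_embed P (t * u) \is a GRing.unit.
    by rewrite loc_embed_unit prime_idealrM negb_or tP.
  rewrite -(mulKr tuU x); case: (span_ideal_ideal (map (loc_embed P) l)) => _ _; apply.
  suff -> : loc_embed P (t * u) * x = loc_embed P (t * a) by apply: span_ideal_map.
  by rewrite !rmorphM /= -xu; ring.
Qed.

(** Clearing denominators in a relation of the localization costs only a multiplier outside [P],
which becomes a unit. *)
Lemma regular_seq_localization (s : seq A) : {subset s <= P} ->
  (forall k x, (k < size s)%N -> span_ideal (take k s) (s`_k * x) ->
     exists t, t \notin P /\ span_ideal (take k s) (t * x)) ->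
  regular_seq (map (loc_embed P) s).
Proof.
move=> sP reg; split.
- move=> k x; rewrite size_map => ks; rewrite -map_take (nth_map 0) //.
  have [a [u [uP xu]]] := localizationP x.
  move/(span_ideal_loc (take k s) (a := s`_k * a) uP) => h.
  have /h [t [tP]] : loc_embed P s`_k * x * loc_embed P u = loc_embed P (s`_k * a).
    by rewrite -mulrA xu rmorphM.
  rewrite mulrCA => /(reg _ _ ks)[v [vP vta]].
  apply/(span_ideal_loc _ uP xu); exists (v * t).
  by rewrite prime_idealrM negb_or vP tP -mulrA.
- have sub : forall x, span_ideal (map (loc_embed P) s) x -> x \in @nonunits (localization P).
    apply: (span_ideal_sub (nonunits_ideal (localization_local P))) => _ /mapP[y ys ->].
    by rewrite inE loc_embed_unit negbK sP.
  by move=> /sub; rewrite inE unitr1.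
Qed.

End LocalizedSpans.

(** Depth never exceeds dimension, because regular sequences cut out chains of primes; so a
regular sequence as long as the longest chain computes both. *)
Lemma cohen_macaulay_local_of_regular_seq (R : comUnitRingType) (s : seq R) :
    local_ring R -> noetherian R -> {subset s <= @nonunits R} -> regular_seq s ->
    (forall n (P : 'I_n.+1 -> prime_idealr R), prime_chain P -> (n <= size s)%N) ->
  cohen_macaulay_local R.
Proof.
move=> locR noethR sN reg dim; split=> //; exists (size s); split; split.
- by exists s.
- by move=> s' _ /regular_seq_chain[P]; apply: dim.
- exact: regular_seq_chain reg.
- exact: dim.
Qed.

Lemma prime_ideal_unit (R : comUnitRingType) (P : prime_idealr R) x :
  x \is a GRing.unit -> x \notin P.
Proof.
by move=> xU; apply/negP => xP; have := idealMr x^-1 xP; rewrite mulVr // idealr1.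
Qed.

(** [x ^+ n] is a combination of the powers of [x] below the degree [m] of its equation. *)
Lemma integralOver_multiplier (A : idomainType) (L : fieldType) (f : {rmorphism A -> L})
    (x : L) a b :
  f b != 0 -> integralOver f x -> x = f a / f b ->
  exists m, forall n, exists c, f (b ^+ m * a ^+ n) = f (c * b ^+ n).
Proof.
move=> b0 [p p_monic px] xE; exists (size p).-1 => n; set m := (size p).-1.
have [q [u [su xn]]] : exists q u : {poly A}, (size u <= m)%N /\ 'X^n = q * p + u.
  exists (Pdiv.Ring.rdivp 'X^n p), (Pdiv.Ring.rmodp 'X^n p); split.
    by rewrite -ltnS prednK ?size_poly_gt0 ?monic_neq0 // Pdiv.Ring.ltn_rmodpN0 ?monic_neq0.
  exact: Pdiv.RingMonic.rdivp_eq.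
have xnE : x ^+ n = (map_poly f u).[x].
  rewrite -hornerXn -(map_polyXn f) xn rmorphD rmorphM hornerD hornerM.
  by rewrite (rootP px) mulr0 add0r.
exists (\sum_(j < m) u`_j * (a ^+ j * b ^+ (m - j))).
have -> : f (b ^+ m * a ^+ n) = f b ^+ m * x ^+ n * f b ^+ n.
  by rewrite rmorphM !rmorphXn xE expr_div_n mulrA divfK ?expf_neq0.
rewrite rmorphM rmorphXn; congr (_ * _).
rewrite xnE (horner_coef_wide (n := m)); last exact: leq_trans (size_poly _ _) su.
rewrite mulr_sumr rmorph_sum; apply: eq_bigr => j _.
rewrite coef_map !rmorphM !rmorphXn mulrCA; congr (_ * _).
have -> : f b ^+ m = f b ^+ j * f b ^+ (m - j) by rewrite -exprD subnKC // ltnW.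
by rewrite xE expr_div_n mulrC mulrA divfK ?expf_neq0.
Qed.

(** Complete integral closedness of [A] in some field containing it, such as one of which its
fraction field is only known to be a subfield, gives integral closedness. *)
Lemma integrally_closed_of_cic (A : idomainType) (L : fieldType) (f : {rmorphism A -> L}) :
    injective f ->
    (forall x d, d != 0 -> (forall n, exists c, f d * x ^+ n = f c) -> exists e, f e = x) ->
  integrally_closed A.
Proof.
move=> f_inj cicA x x_int; have [a [b [b0 xE]]] := fractionP x.
have tb0 : tofrac b != 0 by rewrite tofrac_eq0.
have fb0 : f b != 0 by rewrite -(rmorph0 f) (inj_eq f_inj).
have [m dx] := integralOver_multiplier tb0 x_int xE.
have [|n|e eE] := cicA (f a / f b) (b ^+ m); first by rewrite expf_neq0.
  have [c /eqP] := dx n; rewrite tofrac_eq => /eqP cE; exists c.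
  apply: (mulIf (expf_neq0 n fb0)); rewrite expr_div_n mulrA divfK ?expf_neq0 //.
  by rewrite -!rmorphXn -!rmorphM cE.
exists e; rewrite xE; have -> : a = e * b by apply: f_inj; rewrite rmorphM eE divfK.
by rewrite rmorphM mulfK.
Qed.

(** * The ring generated by the inverses of vectors *)

Section RVTheory.

Variables (F : finFieldType) (V : vectType F).

Local Notation K := (KV V).
Local Notation A := (RV V).
Local Notation r := (\dim {:V}).

Definition RV_val (x : A) : K := val x.

Fact RV_val_zmod : zmod_morphism RV_val. Proof. by []. Qed.
Fact RV_val_monoid : monoid_morphism RV_val. Proof. by []. Qed.

HB.instance Definition _ := GRing.isZmodMorphism.Build A K RV_val RV_val_zmod.
HB.instance Definition _ := GRing.isMonoidMorphism.Build A K RV_val RV_val_monoid.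

Lemma RV_val_inj : injective RV_val. Proof. exact: val_inj. Qed.

Lemma RV_valP x : RV_val x \in flag_ring r.
Proof. by rewrite flag_ring_dim; exact: valP. Qed.

Lemma RV_val_onto z : z \in @flag_ring F V r -> exists x, RV_val x = z.
Proof. by rewrite flag_ring_dim => zR; exists (SubDomain zR). Qed.

Lemma RV_val_onto_seq l : {subset l <= @flag_ring F V r} -> exists l', map RV_val l' = l.
Proof.
elim: l => [|x l IH] lR; first by exists [::].
have [l' <-] := IH (fun y yl => lR y (mem_behead (s := x :: l) yl)).
by have [x' <-] := RV_val_onto (lR x (mem_head _ _)); exists (x' :: l').
Qed.

Fact RV_scal_subproof c : scal V c \in @RV_pred F V.
Proof. by rewrite -flag_ring_dim flag_ring_scal. Qed.

Definition RV_scal (c : F) : A := SubDomain (RV_scal_subproof c).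

Fact RV_scal_zmod : zmod_morphism RV_scal.
Proof. by move=> a b; apply: val_inj; exact: (rmorphB (scal V)). Qed.
Fact RV_scal_monoid : monoid_morphism RV_scal.
Proof.
split; first by apply: val_inj; exact: (rmorph1 (scal V)).
by move=> a b; apply: val_inj; exact: (rmorphM (scal V)).
Qed.

HB.instance Definition _ := GRing.isZmodMorphism.Build F A RV_scal RV_scal_zmod.
HB.instance Definition _ := GRing.isMonoidMorphism.Build F A RV_scal RV_scal_monoid.

Lemma noetherian_RV : noetherian A.
Proof.
have [gens gensP] : exists gens : seq A, map RV_val gens =
    [seq (lform v)^-1 | v <- vectors V].
  apply: RV_val_onto_seq => _ /mapP[v _ ->]; apply: flag_ring_inv; exact: in_flag_dim.
have [R [f [noethR fs fg]]] := finitely_generated_cover RV_scal gens.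
apply: (noetherian_surj (f := f)) noethR => y.
suff H z : z \in @flag_ring F V r -> exists x, RV_val (f x) = z.
  by have [x /RV_val_inj] := H _ (RV_valP y); exists x.
move: z; apply: flag_ring_ind => [c|v v0 _|_ _ [x <-] [x' <-]|_ _ [x <-] [x' <-]].
- by have [b fb] := fs c; exists b; rewrite fb.
- have : (lform v)^-1 \in map RV_val gens by rewrite gensP; apply/map_f/mem_vectors.
  by move=> /mapP[g /fg[b fb] ->]; exists b; rewrite fb.
- by exists (x + x'); rewrite !rmorphD.
- by exists (x * x'); rewrite !rmorphM.
Qed.

Section AtPrime.

Variable Q : prime_idealr A.

Definition RV_image : {pred K} := fun x => `[< exists2 a, a \in Q & RV_val a = x >].

Lemma mem_RV_image a : (RV_val a \in RV_image) = (a \in Q).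
Proof.
apply/asboolP/idP => [[b bQ /RV_val_inj <- //]|aQ]; by exists a.
Qed.

Lemma RV_image_prime : prime_in (@flag_ring F V r) RV_image.
Proof.
split.
- by rewrite -(rmorph0 RV_val) mem_RV_image rpred0.
- by rewrite -(rmorph1 RV_val) mem_RV_image idealr1.
- move=> _ _ /asboolP[a aQ <-] /asboolP[b bQ <-].
  by rewrite -rmorphD mem_RV_image rpredD.
- move=> _ _ /RV_val_onto[a <-] /asboolP[b bQ <-].
  by rewrite -rmorphM mem_RV_image idealMr.
- move=> _ _ /RV_val_onto[a <-] /RV_val_onto[b <-].
  by rewrite -rmorphM !mem_RV_image prime_idealrM.
Qed.

Lemma span_in_RV (l : seq A) x :
  span_in (@flag_ring F V r) (map RV_val l) (RV_val x) <-> span_ideal l x.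
Proof.
split=> [[c [cR]]|[c ->]].
- have /choice[d dP] i : exists d, RV_val d = c i by apply: RV_val_onto.
  rewrite size_map => xE; exists (fun i => d i); apply: RV_val_inj; rewrite xE rmorph_sum.
  by apply: eq_bigr => i _; rewrite rmorphM -dP (nth_map 0).
- rewrite rmorph_sum; apply: span_in_sum => i _; rewrite rmorphM.
  apply: span_inM; first exact: RV_valP.
  by apply: span_in_mem; apply/map_f/mem_nth.
Qed.

(** A chain of primes of length [n] below [Q] and the family [y] combine to an algebraically
independent family, so [n] is at most [r] minus the size of [y], the size of [s]. *)
Lemma cohen_macaulay_local_RV : cohen_macaulay_local (localization Q).
Proof.
have [s [y [[sR sQ] yR reg ind szE]]] := flag_ring_parameters (leqnn _) RV_image_prime.
have [sA sAE] := RV_val_onto_seq sR; have [yA yAE] := RV_val_onto_seq yR.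
rewrite -{}sAE -{}yAE !size_map in sR sQ yR reg ind szE.
have sAQ : {subset sA <= Q}.
  by move=> a aS; rewrite -mem_RV_image; apply: sQ; apply: map_f.
apply: (@cohen_macaulay_local_of_regular_seq _ (map (loc_embed Q) sA)).
- exact: localization_local.
- exact/noetherian_localization/noetherian_RV.
- by move=> _ /mapP[a /sAQ aQ ->]; rewrite inE loc_embed_unit negbK.
- apply: regular_seq_localization => // k x ks /span_in_RV.
  rewrite map_take rmorphM -(nth_map 0 0) // => sx.
  have [|t [tR tQ]] := reg k (RV_val x) _ (RV_valP x) sx; first by rewrite size_map.
  have [u uE] := RV_val_onto tR; rewrite -uE mem_RV_image in tQ *.
  rewrite -map_take -rmorphM => /span_in_RV ux; by exists u.
- move=> n P Pch; rewrite size_map.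
  have eval_val m k (l : seq A) (c : poly_box F m k) :
      box_eval (scal V) (map RV_val l) c = RV_val (box_eval RV_scal l c).
    by rewrite -box_eval_map.
  have indP : independent_mod (loc_embed Q \o RV_scal) (P ord_max) (map (loc_embed Q) yA).
    move=> m; rewrite size_map => c d cd; rewrite !box_eval_map -rmorphB.
    move: (ind m); rewrite size_map => /(_ c d cd).
    rewrite !eval_val -rmorphB mem_RV_image -loc_embed_unit; exact: prime_ideal_unit.
  pose G (x : localization Q) := exists a, x = loc_embed Q a.
  have unitG x : exists u v, u * v = 1 /\ G (x * u).
    have [a [u [uQ xu]]] := localizationP x; exists (loc_embed Q u), (loc_embed Q u)^-1.
    by rewrite mulrV ?loc_embed_unit //; split=> //; exists a.
  have [xs [sxs xsG xsy]] := independent_mod_chain unitG Pch indP.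
  have [xA xAE] : exists xA, map (loc_embed Q) xA = xs.
    elim: (xs) xsG => [|x xs' IH] xsG'; first by exists [::].
    have [xA <-] := IH (fun z zl => xsG' z (mem_behead (s := x :: xs') zl)).
    by have [a ->] := xsG' x (mem_head _ _); exists (a :: xA).
  rewrite -{}xAE size_map -map_cat in sxs xsy.
  have : independent_mod (scal V) [pred z | z == 0] (map RV_val (xA ++ yA)).
    move=> m; rewrite size_map => c d cd; rewrite !eval_val -rmorphB inE.
    apply/negP => /eqP; rewrite -[0](rmorph0 RV_val) => /RV_val_inj cd0.
    move: (xsy m); rewrite size_map => /(_ c d cd).
    by rewrite !box_eval_map -rmorphB cd0 rmorph0 rpred0.
  by move=> /independent_size; rewrite size_map size_cat sxs -szE leq_add2r.
Qed.

End AtPrime.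

Lemma integrally_closed_RV : integrally_closed A.
Proof.
apply: (integrally_closed_of_cic RV_val_inj) => x d d0 dx.
apply: RV_val_onto; apply: (flag_ring_cic (leqnn r) (d := RV_val d)).
- exact: flag_field_dim.
- exact: RV_valP.
- by rewrite -(rmorph0 RV_val) (inj_eq RV_val_inj).
- by move=> n; have [c ->] := dx n; exact: RV_valP.
Qed.

End RVTheory.

Theorem theorem1p7 (F : finFieldType) (V : vectType F)
    (hV : exists v : V, v != 0) :
  [/\ cohen_macaulay (RV V),
      integrally_closed (RV V) &
      GRing.integral_domain_axiom (RV V)].
Proof.
split.
- split; first exact: noetherian_RV.
  by move=> Q _; exact: cohen_macaulay_local_RV.
- exact: integrally_closed_RV.
- by move=> x y /eqP; rewrite mulf_eq0.
Qed.
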